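(* The family of associahedra, oriented by the Tamari order, is $2$-short, has asymptotic $k$-length $\frac{k-2}{2k-2}$ for every $k>2$, and has asymptotic total length $\frac12$.
   Context: An oriented polytope is a convex polytope $P\subset\mathbb{R}^d$ together with a linear functional $\psi$ that is not constant along any edge of $P$. The functional orients each edge, and the vertex set of $P$ becomes a poset by taking the reflexive-transitive closure of this orientation. Every nonempty face has a unique bottom vertex and a unique top vertex. For nonempty faces $F,G$ write $F\le G$ if the top vertex of $F$ is less than or equal to the bottom vertex of $G$ in the vertex poset of $P$. A face chain of length $k$ in $P$ is a sequence $\mathbf{F}=(F_1\le F_2\le\cdots\le F_k)$ of nonempty faces of $P$. Its excess is $\mathrm{exc}(\mathbf{F})=(\dim P-1)-\sum_{i=1}^k(\dim F_i-1)$. Let $e_k(P)$ be the minimum excess of a length $k$ face chain in $P$ (for $k=1$ the trivial chain consisting of $P$ itself is excluded). Let $E_k(n)=(n-1)-k(n-2)=(1-k)n+2k-1$. A family of polytopes $P^\bullet$ consists of one oriented polytope $P^n$ of dimension $n$ for each $n\ge1$. The family is $2$-short if in each $P^n$ every face chain of length $2$ has positive excess. It has asymptotic $k$-length $\alpha_k$ if $\lim_{n\to\infty} e_k(P^n)/E_k(n)=\alpha_k$. It has asymptotic total length $\alpha$ if the $\alpha_k$ are well-defined for every $k$ and $\lim_{k\to\infty}\alpha_k=\alpha$. The associahedron $K(N)$ is the $(N-2)$-dimensional polytope (Loday's realization) whose poset of nonempty faces is isomorphic to the poset of planar rooted trees with $N$ leaves in which every inner vertex has at least two children, ordered by contraction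 of inner edges (contracting inner edges gives larger faces). The face labelled by a tree with $e$ inner edges has dimension $N-2-e$. Vertices correspond to planar binary rooted trees. A linear functional orients the $1$-skeleton so that the vertex poset is the Tamari order, whose generating relations are right rotations of a tree: replacing a subtree $((A\,B)\,C)$ by $(A\,(B\,C))$ makes the tree larger. Thus the left comb is the minimum and the right comb is the maximum. The $n$-dimensional member of the family of associahedra is $K(n+2)$. *)

(* Defs.v *)
From Stdlib Require Import Relation_Operators.
From mathcomp Require Import all_boot all_order all_algebra.
From mathcomp Require Import all_classical all_reals all_analysis.

Set Implicit Arguments.
Unset Strict Implicit.
Unset Printing Implicit Defensive.

Import Order.TTheory GRing.Theory Num.Theory.
Import numFieldNormedType.Exports.

Local Open Scope classical_set_scope.
Local Open Scope ring_scope.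

Definition convex_hull (R : realType) (d : nat) (A : set 'rV[R]_d) :
  set 'rV[R]_d := smallest (@convex_set R 'rV[R]_d) A.

Definition convex_polytope (R : realType) (d : nat) (P : set 'rV[R]_d) : Prop :=
  exists A : set 'rV[R]_d, [/\ finite_set A, A !=set0 & P = convex_hull A].

Definition affinely_independent (R : realType) (d r : nat)
  (x : 'I_r.+1 -> 'rV[R]_d) : Prop :=
  row_free (\matrix_(i < r) (x (lift ord0 i) - x ord0)).

(* The dimension of the affine hull of F: the largest r such that F contains
   r + 1 affinely independent points.  It is only used for nonempty F. *)
Definition affine_dim (R : realType) (d : nat) (F : set 'rV[R]_d) : nat :=
  \max_(r < d.+1 |
    `[< exists x : 'I_r.+1 -> 'rV[R]_d,
          (forall i, F (x i)) /\ affinely_independent x >]) r.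

(* Nonempty faces; P itself is one of them (take phi = 0). *)
Definition face (R : realType) (d : nat) (P F : set 'rV[R]_d) : Prop :=
  F !=set0 /\
  exists phi : {scalar 'rV[R]_d},
    F = [set x | P x /\ forall y, P y -> phi y <= phi x].

Definition edge (R : realType) (d : nat) (P E : set 'rV[R]_d) : Prop :=
  face P E /\ affine_dim E = 1%N.

Definition vertex (R : realType) (d : nat) (P : set 'rV[R]_d) (v : 'rV[R]_d) :
  Prop := face P [set v].

Record oriented_polytope (R : realType) (d : nat) := OrientedPolytope {
  body :> set 'rV[R]_d;
  functional : {scalar 'rV[R]_d};
  body_polytope : convex_polytope body;
  functional_edge : forall E, edge body E ->
    exists x y, [/\ E x, E y & functional x != functional y] }.

Definition oriented_edge (R : realType) (d : nat) (P : oriented_polytope R d)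
  (v w : 'rV[R]_d) : Prop :=
  [/\ vertex P v, vertex P w, exists E, [/\ edge P E, E v & E w]
    & functional P v < functional P w].

Definition vertex_le (R : realType) (d : nat) (P : oriented_polytope R d) :
  'rV[R]_d -> 'rV[R]_d -> Prop := clos_refl_trans _ (oriented_edge P).

Definition bottom_vertex (R : realType) (d : nat) (P : oriented_polytope R d)
  (F : set 'rV[R]_d) (v : 'rV[R]_d) : Prop :=
  [/\ vertex P v, F v & forall w, vertex P w -> F w -> vertex_le P v w].

Definition top_vertex (R : realType) (d : nat) (P : oriented_polytope R d)
  (F : set 'rV[R]_d) (v : 'rV[R]_d) : Prop :=
  [/\ vertex P v, F v & forall w, vertex P w -> F w -> vertex_le P w v].

Definition face_le (R : realType) (d : nat) (P : oriented_polytope R d)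
  (F G : set 'rV[R]_d) : Prop :=
  exists t b, [/\ top_vertex P F t, bottom_vertex P G b & vertex_le P t b].

Definition face_chain (R : realType) (d : nat) (P : oriented_polytope R d)
  (k : nat) (F : 'I_k -> set 'rV[R]_d) : Prop :=
  (forall i, face P (F i)) /\
  (forall i j : 'I_k, j = i.+1 :> nat -> face_le P (F i) (F j)).

Definition excess (R : realType) (d : nat) (P : oriented_polytope R d)
  (k : nat) (F : 'I_k -> set 'rV[R]_d) : int :=
  ((affine_dim P)%:Z - 1) - \sum_(i < k) ((affine_dim (F i))%:Z - 1).

(* The chains over which the minimum defining e_k(P) is taken. *)
Definition admissible_chain (R : realType) (d : nat) (P : oriented_polytope R d)
  (k : nat) (F : 'I_k -> set 'rV[R]_d) : Prop :=
  face_chain P F /\ (k = 1%N -> forall i, F i <> P).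

(* e_k(P) = e *)
Definition is_min_excess (R : realType) (d : nat) (P : oriented_polytope R d)
  (k : nat) (e : int) : Prop :=
  (exists F : 'I_k -> set 'rV[R]_d, admissible_chain P F /\ excess P F = e) /\
  (forall F : 'I_k -> set 'rV[R]_d, admissible_chain P F -> e <= excess P F).

Definition E_ (k n : nat) : int := (n%:Z - 1) - k%:Z * (n%:Z - 2).

(* Families are indexed by all n for convenience; the member at n = 0 is
   junk and is ignored by every definition below.  The requirement that the
   n-th member be n-dimensional is the predicate graded. *)
Definition polytope_family (R : realType) (d : nat -> nat) : Type :=
  forall n, oriented_polytope R (d n).

Definition graded (R : realType) (d : nat -> nat) (P : polytope_family R d) :
  Prop := forall n, (0 < n)%N -> affine_dim (P n) = n.

Definition two_short (R : realType) (d : nat -> nat) (P : polytope_family R d) :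
  Prop :=
  forall n, (0 < n)%N ->
  forall F : 'I_2 -> set 'rV[R]_(d n), face_chain (P n) F ->
  0 < excess (P n) F.

Definition asymptotic_length (R : realType) (d : nat -> nat)
  (P : polytope_family R d) (k : nat) (alpha : R) : Prop :=
  exists e : nat -> int,
    (forall n, (0 < n)%N -> is_min_excess (P n) k (e n)) /\
    (fun n => (e n)%:~R / (E_ k n)%:~R : R) @ \oo --> alpha.

Definition asymptotic_total_length (R : realType) (d : nat -> nat)
  (P : polytope_family R d) (alpha : R) : Prop :=
  exists alpha_ : nat -> R,
    (forall k, (0 < k)%N -> asymptotic_length P k (alpha_ k)) /\
    alpha_ @ \oo --> alpha.

Inductive bintree : Type :=
| Leaf
| Node of bintree & bintree.

Fixpoint leaves (t : bintree) : nat :=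
  if t is Node l r then (leaves l + leaves r)%N else 1%N.

(* Replacing a subtree ((A B) C) by (A (B C)). *)
Inductive right_rotation : bintree -> bintree -> Prop :=
| RotRoot A B C : right_rotation (Node (Node A B) C) (Node A (Node B C))
| RotLeft l l' r : right_rotation l l' -> right_rotation (Node l r) (Node l' r)
| RotRight l r r' : right_rotation r r' -> right_rotation (Node l r) (Node l r').

Definition tamari_le : bintree -> bintree -> Prop :=
  clos_refl_trans _ right_rotation.

(* The inner vertices in left-to-right (infix) order, each contributing
   (number of leaves on its left) * (number of leaves on its right). *)
Fixpoint loday_coords (t : bintree) : seq nat :=
  if t is Node l r
  then loday_coords l ++ (leaves l * leaves r)%N :: loday_coords r
  else [::].

Definition loday_point (R : realType) (n : nat) (t : bintree) : 'rV[R]_n.+1 :=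
  \row_(i < n.+1) (nth 0%N (loday_coords t) i)%:R.

(* Loday's realization of K(n + 2). *)
Definition associahedron (R : realType) (n : nat) : set 'rV[R]_n.+1 :=
  convex_hull [set loday_point R n t | t in [set t | leaves t = n.+2]].

Arguments associahedron R n : clear implicits.

(* The functional of K n is any one inducing the Tamari order, for instance
   x |-> - \sum_i i * x_i: a right rotation moves x in a direction
   e_i - e_j with i < j. *)
Definition tamari_associahedra (R : realType) (K : polytope_family R S) : Prop :=
  forall n, (0 < n)%N ->
    body (K n) = associahedron R n /\
    (forall t u, leaves t = n.+2 -> leaves u = n.+2 ->
       vertex_le (K n) (loday_point R n t) (loday_point R n u) <->
       tamari_le t u).

(* Main.v *)
(* At a vertex t of Loday's associahedron, a binary tree, the polytope lies in
   the cone spanned by the n rotations of t: the coefficient of a point x along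
   the rotation that destroys a subtree of t is a positive multiple of the slack
   at x of Loday's inequality for that subtree.  Hence the dimension of a face F
   containing t is the number of rotations of t that stay in F, and rotating
   within F, as in the simplex method, reaches the top and the bottom vertex of
   F.  At the top vertex only rotations of right children stay in F, at the
   bottom vertex only those of left children.  As the number of right children
   weakly increases along the Tamari order and every tree has n non-root inner
   vertices, F <= G implies dim F + dim G <= n; this is 2-shortness, and summing
   over pairs bounds the total dimension of a chain of length k by k n / 2.
   Trees whose inner vertices form a path, encoded by words in {L, R}, give a
   chain of cubes of dimensions n/2, n/2 - 1, ... that matches this bound up to
   a constant depending on k. *)
From Stdlib Require Import Relation_Operators Operators_Properties.
From HB Require Import structures.
Require Import Defs.
From mathcomp Require Import all_boot all_order all_algebra.
From mathcomp Require Import all_classical all_reals all_analysis.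
From mathcomp Require unstable.
From mathcomp Require Import zify ring lra.

Set Implicit Arguments.
Unset Strict Implicit.
Unset Printing Implicit Defensive.

Import Order.TTheory GRing.Theory Num.Theory.
Import numFieldNormedType.Exports.

Local Open Scope nat_scope.

(** * Subtrees and rotations *)

Fixpoint inner (t : bintree) : nat :=
  if t is Node l r then (inner l + inner r).+1 else 0.

Lemma leaves_inner t : leaves t = (inner t).+1.
Proof. by elim: t => //= l -> r ->; lia. Qed.

Lemma size_loday_coords t : size (loday_coords t) = inner t.
Proof. by elim: t => //= l IHl r IHr; rewrite size_cat /= IHl IHr addnS. Qed.

(* A subtree of a tree whose inner vertices are numbered o, o + 1, ... from
   left to right is recorded as the pair (first inner vertex, number of inner
   vertices). *)
Definition root_sub (t : bintree) (o : nat) : seq (nat * nat) :=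
  if t is Node _ _ then [:: (o, inner t)] else [::].

Fixpoint subs (t : bintree) (o : nat) : seq (nat * nat) :=
  if t is Node l r then
    (o, inner t) :: subs l o ++ subs r (o + (inner l).+1)
  else [::].

(* The subtrees in [subs t o], except t itself, that are left ([b = true]) or
   right ([b = false]) children of their parent. *)
Fixpoint kids (b : bool) (t : bintree) (o : nat) : seq (nat * nat) :=
  if t is Node l r then
    let o' := o + (inner l).+1 in
    (if b then root_sub l o else root_sub r o') ++ kids b l o ++ kids b r o'
  else [::].

(** Upward for [b = true], downward for [b = false]: these destroy a left, respectively a right
    child, in agreement with the flag of [kids]. *)
Definition rotation (b : bool) (t u : bintree) : Prop :=
  if b then right_rotation t u else right_rotation u t.

Lemma perm_subs t o :
  perm_eq (subs t o) (root_sub t o ++ kids true t o ++ kids false t o).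
Proof.
elim: t o => //= l IHl r IHr o; rewrite perm_cons.
set o' := o + _; apply/permP => p; rewrite !count_cat.
by move/permP: (IHl o) => ->; move/permP: (IHr o') => ->; rewrite !count_cat; lia.
Qed.

Lemma size_subs t o : size (subs t o) = inner t.
Proof. by elim: t o => //= l IHl r IHr o; rewrite size_cat IHl IHr. Qed.

Lemma mem_subs t o c : c \in subs t o ->
  [/\ o <= c.1, c.1 + c.2 <= o + inner t & 0 < c.2].
Proof.
elim: t o => //= l IHl r IHr o; rewrite inE mem_cat => /or3P[/eqP ->|/IHl|/IHr] /=.
- by split; lia.
- by case=> *; split; lia.
- by case=> *; split; lia.
Qed.

Lemma uniq_subs t o : uniq (subs t o).
Proof.
elim: t o => //= l IHl r IHr o; rewrite cat_uniq IHl IHr andbT /= mem_cat negb_or.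
apply/andP; split; first (apply/andP; split).
- by apply/negP => /mem_subs[] /=; lia.
- by apply/negP => /mem_subs[] /=; lia.
- by apply/hasPn => c /mem_subs[h1 h2 h3]; apply/negP => /mem_subs[]; lia.
Qed.

Lemma size_kids t o :
  inner t = size (root_sub t o) + size (kids true t o) + size (kids false t o).
Proof. by rewrite -(size_subs t o) (perm_size (perm_subs t o)) !size_cat addnA. Qed.

Lemma size_kidsE b t o o' : size (kids b t o) = size (kids b t o').
Proof.
elim: t o o' => //= l IHl r IHr o o'; rewrite !size_cat.
rewrite (IHl o o') (IHr (o + _) (o' + (inner l).+1)).
by case: b {IHl IHr}; [case: l | case: r].
Qed.

Lemma right_rotation_inner t u : right_rotation t u -> inner u = inner t.
Proof. by elim=> [A B C|l l' r _ /= ->|l r r' _ /= ->] //=; lia. Qed.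

Lemma rotation_leaves b t u : rotation b t u -> leaves u = leaves t.
Proof. by rewrite !leaves_inner; case: b => /= /right_rotation_inner ->. Qed.

(** Rotating ((A B) C) turns the right child B into a left child but creates the right child (B C),
    so the balance is 0, or 1 if B is a leaf. *)
Lemma right_rotation_kids t u o : right_rotation t u ->
  size (kids false t o) <= size (kids false u o).
Proof.
have szr v : size (root_sub v 0) <= 1 by case: v.
have E v p : size (root_sub v p) = size (root_sub v 0) by case: v.
have K v p := size_kidsE false v p 0.
have N v w : right_rotation v w -> size (root_sub v 0) = size (root_sub w 0).
  by case.
move=> h; elim: h o => [A B C|l l' r h IH|l r r' h IH] o.
all: rewrite /= ?size_cat !E !K /= ?size_cat ?E ?K.
- by have := szr B; lia.
- by have := IH 0; lia.
- by have := IH 0; have := N _ _ h; lia.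
Qed.

Lemma tamari_le_kids t u o : tamari_le t u ->
  size (kids false t o) <= size (kids false u o).
Proof.
elim=> // [v w /right_rotation_kids -> //|v w x _ h1 _]; exact: leq_trans.
Qed.

Lemma rotation_node_l b l l' r : rotation b l l' -> rotation b (Node l r) (Node l' r).
Proof. by case: b; apply: RotLeft. Qed.

Lemma rotation_node_r b l r r' : rotation b r r' -> rotation b (Node l r) (Node l r').
Proof. by case: b; apply: RotRight. Qed.

Lemma rotation_inner b t u : rotation b t u -> inner u = inner t.
Proof. by case: b => /= /right_rotation_inner ->. Qed.

(** The excluded interval is the destroyed subtree (A B). Rotation preserves the infix numbering, so
    all other subtrees keep their intervals. *)
Lemma subs_RotRoot A B C o c :
  c != (o, (inner A + inner B).+1) ->
  c \in subs (Node (Node A B) C) o ->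
  c \in subs (Node A (Node B C)) o.
Proof.
move=> h /=; rewrite !inE !mem_cat !inE !mem_cat (negPf h) /=.
rewrite (_ : o + (inner A + inner B).+2 = o + (inner A).+1 + (inner B).+1); last lia.
rewrite (_ : (inner A + inner B).+1 + inner C = inner A + (inner B + inner C).+1); last lia.
by move=> /or3P[->|/orP[]->|->]; rewrite ?orbT.
Qed.

Lemma subs_RotRoot_inv A B C o c :
  c != (o + (inner A).+1, (inner B + inner C).+1) ->
  c \in subs (Node A (Node B C)) o ->
  c \in subs (Node (Node A B) C) o.
Proof.
move=> h /=; rewrite !inE !mem_cat !inE !mem_cat (negPf h) /=.
rewrite (_ : o + (inner A + inner B).+2 = o + (inner A).+1 + (inner B).+1); last lia.
rewrite (_ : (inner A + inner B).+1 + inner C = inner A + (inner B + inner C).+1); last lia.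
by move=> /or3P[->|->|/orP[]->]; rewrite ?orbT.
Qed.

Lemma kid_rotation b t o c : c \in kids b t o ->
  exists2 u, rotation b t u &
    forall c', c' != c -> c' \in subs t o -> c' \in subs u o.
Proof.
elim: t o => //= l IHl r IHr o; rewrite !mem_cat => /or3P[|/IHl[u tu hu]|/IHr[u tu hu]].
- case: b {IHl IHr}.
    case: l => //= A B; rewrite inE => /eqP ->.
    exists (Node A (Node B r)); first exact: RotRoot.
    exact: subs_RotRoot.
  case: r => //= B C; rewrite inE => /eqP ->.
  exists (Node (Node l B) C); first exact: RotRoot.
  exact: subs_RotRoot_inv.
- exists (Node u r); first exact: rotation_node_l.
  move=> c' nc /=; rewrite (rotation_inner tu) !inE !mem_cat.
  by move=> /or3P[->|/(hu _ nc)->|->]; rewrite ?orbT.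
- exists (Node l u); first exact: rotation_node_r.
  move=> c' nc /=; rewrite (rotation_inner tu) !inE !mem_cat.
  by move=> /or3P[->|->|/(hu _ nc)->]; rewrite ?orbT.
Qed.

Lemma rotation_kid b t u o : rotation b t u ->
  exists2 c, c \in kids b t o &
    forall c', c' != c -> c' \in subs t o -> c' \in subs u o.
Proof.
case: b => /= tu; elim: tu o => [A B C|l l' r h IH|l r r' h IH] o /=.
- exists (o, (inner A + inner B).+1); first by rewrite mem_head.
  by move=> c'; apply: subs_RotRoot.
- have [c hc hu] := IH o; exists c; first by rewrite !mem_cat hc orbT.
  move=> c' nc /=; rewrite (right_rotation_inner h) !inE !mem_cat.
  by move=> /or3P[->|/(hu _ nc)->|->]; rewrite ?orbT.
- have [c hc hu] := IH (o + (inner l).+1); exists c; first by rewrite !mem_cat hc !orbT.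
  move=> c' nc /=; rewrite (right_rotation_inner h) !inE !mem_cat.
  by move=> /or3P[->|->|/(hu _ nc)->]; rewrite ?orbT.
- exists (o + (inner A).+1, (inner B + inner C).+1); first by rewrite mem_head.
  by move=> c'; apply: subs_RotRoot_inv.
- have [c hc hu] := IH o; exists c; first by rewrite !mem_cat hc orbT.
  move=> c' nc /=; rewrite (right_rotation_inner h) !inE !mem_cat.
  by move=> /or3P[->|/(hu _ nc)->|->]; rewrite ?orbT.
- have [c hc hu] := IH (o + (inner l).+1); exists c; first by rewrite !mem_cat hc !orbT.
  move=> c' nc /=; rewrite (right_rotation_inner h) !inE !mem_cat.
  by move=> /or3P[->|->|/(hu _ nc)->]; rewrite ?orbT.
Qed.

(** * Loday's inequalities *)

Lemma binS2 m : 'C(m.+1, 2) = m + 'C(m, 2).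
Proof. by rewrite binS bin1 addnC. Qed.

(** Pairs of leaves are counted by side: both among the first a + 1, one on each side, both among
    the last b + 1. *)
Lemma bin2_split a b : 'C((a + b).+2, 2) = 'C(a.+1, 2) + a.+1 * b.+1 + 'C(b.+1, 2).
Proof.
elim: b => [|b IH]; first by rewrite addn0 binS2 muln1 addn0 addnC.
by rewrite addnS binS2 IH [in RHS](binS2 b.+1); lia.
Qed.

Definition interval_sum (s : seq nat) (c : nat * nat) : nat :=
  sumn (take c.2 (drop c.1 s)).

Lemma sumn_loday_coords t : sumn (loday_coords t) = 'C((inner t).+1, 2).
Proof.
elim: t => //= l IHl r IHr.
by rewrite sumn_cat /= IHl IHr !leaves_inner addnA bin2_split.
Qed.

(* The inner vertices of an interval that contains the root, at position a in
   the interval, see at least the leaves of the interval itself. *)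
Lemma interval_sum_root l r o m : o <= inner l < o + m ->
  o + m <= (inner l + inner r).+1 ->
  exists a b, [/\ m = (a + b).+1, a <= inner l, b <= inner r,
    o + a = inner l &
    interval_sum (loday_coords (Node l r)) (o, m) =
    interval_sum (loday_coords l) (o, a) + leaves l * leaves r
      + interval_sum (loday_coords r) (0, b)].
Proof.
move=> /andP[h1 h2] h3; exists (inner l - o), (o + m - (inner l).+1).
split; try lia; rewrite /interval_sum /= drop_cat size_loday_coords.
case: ltngtP h1 => [h1 _| |h1 _] //.
  rewrite take_cat size_drop size_loday_coords ltnNge (_ : inner l - o <= m); last lia.
  rewrite /= sumn_cat drop0 -addnA; congr (_ + _).
    by rewrite take_oversize // size_drop size_loday_coords.
  have -> : m - (inner l - o) = (o + m - (inner l).+1).+1 by lia.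
  by [].
rewrite h1 subnn take0 drop0 /= drop0.
case: m h2 h3 => [|m] h2 h3; first lia.
by rewrite (_ : inner l + m.+1 - (inner l).+1 = m) //; lia.
Qed.

(** An interval missing the root lies in one child. One containing it splits at the root, whose
    coordinate is at least (a + 1)(b + 1), and [bin2_split] assembles the three parts. *)
Lemma loday_inequality t o m : o + m <= inner t ->
  'C(m.+1, 2) <= interval_sum (loday_coords t) (o, m).
Proof.
elim: t o m => [|l IHl r IHr] o m /=.
  by rewrite leqn0 addn_eq0 => /andP[_ /eqP ->].
move=> hom.
have [h|h] := leqP (o + m) (inner l).
  rewrite (_ : interval_sum _ _ = interval_sum (loday_coords l) (o, m)); first exact: IHl.
  by rewrite /interval_sum /= !take_drop takel_cat // size_loday_coords addnC.
have [h'|h'] := leqP o (inner l).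
  have [||a [b [-> ha hb hoa ->]]] := @interval_sum_root l r o m; try lia.
  rewrite bin2_split !leaves_inner; apply: leq_add; first apply: leq_add.
  - by apply: IHl; lia.
  - by apply: leq_mul; lia.
  - exact: IHr.
rewrite /interval_sum /= drop_cat size_loday_coords.
rewrite (_ : o < inner l = false); last lia.
have -> : o - inner l = (o - (inner l).+1).+1 by lia.
by apply: IHr; lia.
Qed.

(** The surrounding coordinates [p] and [q] let the induction descend into either child. *)
Lemma loday_equality t p q c : c \in subs t (size p) ->
  interval_sum (p ++ loday_coords t ++ q) c = 'C(c.2.+1, 2).
Proof.
elim: t p q => //= l IHl r IHr p q.
rewrite inE mem_cat => /or3P[/eqP->|hc|hc].
- rewrite /interval_sum /= drop_size_cat // take_size_cat.
    exact: (sumn_loday_coords (Node l r)).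
  by rewrite (size_loday_coords (Node l r)).
- by rewrite -catA; apply: IHl.
- rewrite -catA catA -cat_rcons; apply: IHr.
  by rewrite size_rcons size_cat size_loday_coords -addnS.
Qed.

Lemma loday_equality0 t c : c \in subs t 0 ->
  interval_sum (loday_coords t) c = 'C(c.2.+1, 2).
Proof. by have := @loday_equality t [::] [::] c; rewrite /= cats0. Qed.

(** Otherwise the interval of [l'], tight for the second tree, contains the root of the first. That
    root has more leaves on its right than the interval provides, so the inequality would be
    strict. *)
Lemma loday_coords_root l r l' r' :
  loday_coords (Node l r) = loday_coords (Node l' r') -> inner l' <= inner l.
Proof.
move=> E; rewrite leqNgt; apply/negP => lt_ll'.
have := congr1 size E; rewrite !size_loday_coords /= => sz.
have e1 : interval_sum (loday_coords (Node l' r')) (0, inner l') = 'C((inner l').+1, 2).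
  rewrite /interval_sum /= drop0 take_size_cat ?size_loday_coords //.
  exact: sumn_loday_coords.
have [||a [b [hm ha hb hoa]]] := @interval_sum_root l r 0 (inner l'); try lia.
rewrite E e1 hm bin2_split !leaves_inner.
have := @loday_inequality l 0 a; have := @loday_inequality r 0 b.
by rewrite !add0n => /(_ hb) + /(_ ha); nia.
Qed.

Lemma loday_coords_inj : injective loday_coords.
Proof.
elim=> [|l IHl r IHr] [|l' r'] //; try by rewrite /=; case: (loday_coords _).
move=> E; have eq_ll' : inner l = inner l'.
  by apply/anti_leq; rewrite !(loday_coords_root E, loday_coords_root (esym E)).
move/eqP: E; rewrite /= eqseq_cat ?size_loday_coords // => /andP[/eqP/IHl -> /eqP[_]].
by move=> /IHr ->.
Qed.

(** * The orienting functional *)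

(** This is the sum of all i * s_i, in a recursive form that follows concatenation; up to sign it is
    the orienting functional. *)
Fixpoint weight (s : seq nat) : nat :=
  if s is _ :: s' then weight s' + sumn s' else 0.

Lemma weight_cat s1 s2 : weight (s1 ++ s2) = weight s1 + weight s2 + size s1 * sumn s2.
Proof. by elim: s1 => [|x s1 IH] /=; rewrite ?IH ?sumn_cat; lia. Qed.

(** Rotating ((A B) C) moves the amount [leaves A * leaves C] from the coordinate just after B to
    the one just before B. *)
Lemma right_rotation_weight t u : right_rotation t u ->
  weight (loday_coords u) < weight (loday_coords t).
Proof.
elim=> [A B C|l l' r h IH|l r r' h IH] /=; rewrite !(weight_cat, sumn_cat, size_cat) /=;
  rewrite ?(weight_cat, sumn_cat) /=;
  rewrite !size_loday_coords !sumn_loday_coords !leaves_inner.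
- nia.
- by rewrite (right_rotation_inner h); lia.
- by rewrite (right_rotation_inner h); lia.
Qed.

Lemma weightE s : weight s = \sum_(0 <= i < size s) i * nth 0 s i.
Proof.
elim: s => [|x s IH]; first by rewrite big_nil.
rewrite big_nat_recl // mul0n add0n /= IH.
have -> : sumn s = \sum_(0 <= i < size s) nth 0 s i.
  by rewrite sumnE (big_nth 0).
by rewrite -big_split /=; apply: eq_bigr => i _; lia.
Qed.

Local Open Scope classical_set_scope.
Local Open Scope ring_scope.

(** * Affine dimension and convex hulls *)

Section AffineDim.
Variables (R : realType) (d : nat).
Implicit Types (F : set 'rV[R]_d).

Lemma affine_dim_le F r (D : 'M[R]_(r, d)) (x0 : 'rV[R]_d) :
  (forall x, F x -> (x - x0 <= D)%MS) -> (affine_dim F <= r)%N.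
Proof.
move=> FD; apply/bigmax_leqP => k /asboolP[x [Fx /eqP <-]].
apply: leq_trans (rank_leq_row D); apply: mxrankS; apply/row_subP => i.
rewrite rowK (_ : _ - _ = (x (lift ord0 i) - x0) - (x ord0 - x0)); last first.
  by rewrite opprB addrA subrK.
by rewrite addmx_sub ?eqmx_opp ?FD.
Qed.

Lemma affine_dim_ge F r (x : 'I_r.+1 -> 'rV[R]_d) :
  (forall i, F (x i)) -> affinely_independent x -> (r <= affine_dim F)%N.
Proof.
move=> Fx xI; have rd : (r < d.+1)%N.
  by rewrite ltnS; move/eqP: xI => <-; exact: rank_leq_col.
rewrite -[leqLHS]/(nat_of_ord (Ordinal rd)); apply: leq_bigmax_cond.
by apply/asboolP; exists x.
Qed.

Lemma convex_hull_le (A : set 'rV[R]_d) (phi : {scalar 'rV[R]_d}) a :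
  (forall x, A x -> phi x <= a) -> forall x, convex_hull A x -> phi x <= a.
Proof.
move=> Aa x; apply: (smallest_sub (G := A) (X := [set x | phi x <= a])) => //.
move=> u v k; rewrite !inE /= => ua va.
rewrite linearD !linearZ /=.
have k0 : 0 <= k%:num := ge0 k; have k1 : k%:num <= 1 := le1 k.
have : 0 <= k%:num * (a - phi u) by rewrite mulr_ge0 ?subr_ge0.
have : 0 <= (1 - k%:num) * (a - phi v) by rewrite mulr_ge0 ?subr_ge0.
by rewrite /GRing.scale /= /unstable.onem; lra.
Qed.

End AffineDim.

(** * Points of the associahedron *)

Section Geometry.
Variables (R : realType) (n : nat).
Implicit Types (t u : bintree) (c : nat * nat) (x : 'rV[R]_n.+1).
Local Notation V := 'rV[R]_n.+1.
Local Notation P := (associahedron R n).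
Local Notation pt := (loday_point R n).

(** The linear form of Loday's inequality for the interval [c]. It has this meaning when
    [c.1 + c.2 <= n.+1]; beyond that [inord] falls back to index 0. *)
Definition isum c (x : V) : R := \sum_(c.1 <= j < c.1 + c.2) x 0 (inord j).

Fact isum_is_linear c : linear (isum c : V -> R).
Proof.
move=> a x y; rewrite /isum scaler_sumr -big_split /=.
by apply: eq_bigr => j _; rewrite !mxE.
Qed.
HB.instance Definition _ c := GRing.isLinear.Build R V R _ (isum c) (isum_is_linear c).

(** Negated because [face] maximizes: this functional exposes the face on which all inequalities of
    [N] are tight. *)
Definition neg_isums (N : seq (nat * nat)) (x : V) : R := - \sum_(c <- N) isum c x.

Fact neg_isums_is_linear N : linear (neg_isums N).
Proof.
move=> a x y; rewrite /neg_isums scalerN -opprD scaler_sumr -big_split /=.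
by congr (- _); apply: eq_bigr => c _; rewrite linearP.
Qed.
HB.instance Definition _ N :=
  GRing.isLinear.Build R V R _ (neg_isums N) (neg_isums_is_linear N).

Definition height (x : V) : R := - \sum_(i < n.+1) i%:R * x 0 i.

Fact height_is_linear : linear height.
Proof.
move=> a x y; rewrite /height scalerN -opprD scaler_sumr -big_split /=.
by congr (- _); apply: eq_bigr => i _; rewrite !mxE /GRing.scale /=; ring.
Qed.
HB.instance Definition _ := GRing.isLinear.Build R V R _ height height_is_linear.

Lemma leaves_size t : leaves t = n.+2 -> size (loday_coords t) = n.+1.
Proof. by rewrite leaves_inner size_loday_coords => -[]. Qed.

Lemma leaves_inner2 t : leaves t = n.+2 -> inner t = n.+1.
Proof. by rewrite leaves_inner => -[]. Qed.

Lemma isum_loday_point t c : leaves t = n.+2 -> (c.1 + c.2 <= n.+1)%N ->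
  isum c (pt t) = (interval_sum (loday_coords t) c)%:R.
Proof.
case: c => o m lt /= h; rewrite /isum /interval_sum /=.
have sz : size (take m (drop o (loday_coords t))) = m.
  by rewrite size_take_min size_drop leaves_size //; lia.
rewrite sumnE [in RHS](big_nth 0%N) sz natr_sum -{1}(add0n o) big_addn addKn.
by apply: eq_big_nat => j jm; rewrite mxE inordK ?nth_take ?nth_drop 1?addnC //; lia.
Qed.

Lemma height_loday_point t : leaves t = n.+2 ->
  height (pt t) = - (weight (loday_coords t))%:R.
Proof.
move=> lt; rewrite /height weightE leaves_size // big_mkord natr_sum.
by congr (- _); apply: eq_bigr => i _; rewrite mxE natrM.
Qed.

Lemma loday_point_inj t u : leaves t = n.+2 -> leaves u = n.+2 ->
  pt t = pt u -> t = u.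
Proof.
move=> lt lu /rowP E; apply: loday_coords_inj; apply: (@eq_from_nth _ 0%N).
  by rewrite !leaves_size.
move=> i; rewrite leaves_size // => hi; have := E (Ordinal hi); rewrite !mxE /=.
by move/eqP; rewrite eqr_nat => /eqP.
Qed.

Lemma loday_point_mem t : leaves t = n.+2 -> P (pt t).
Proof. by move=> lt; apply: sub_gen_smallest; exists t. Qed.

Lemma associahedron_le (phi : {scalar V}) a :
  (forall t, leaves t = n.+2 -> phi (pt t) <= a) -> forall x, P x -> phi x <= a.
Proof. by move=> h; apply: convex_hull_le => _ [t /h ? <-]. Qed.

Lemma neg_isums1 c x : neg_isums [:: c] x = - isum c x.
Proof. by rewrite /neg_isums big_seq1. Qed.

Lemma isum_ge c x : (c.1 + c.2 <= n.+1)%N -> P x ->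
  ('C(c.2.+1, 2))%:R <= isum c x.
Proof.
move=> hc Px; rewrite -lerN2 -neg_isums1.
apply: (associahedron_le (phi := neg_isums [:: c])) Px => t lt.
rewrite /= neg_isums1 lerN2 isum_loday_point // ler_nat.
by case: c hc => o m /= hc; apply: loday_inequality; rewrite (leaves_inner2 lt).
Qed.

Lemma isum_loday_point_sub t c : leaves t = n.+2 -> c \in subs t 0 ->
  isum c (pt t) = ('C(c.2.+1, 2))%:R.
Proof.
move=> lt hc; rewrite isum_loday_point ?loday_equality0 //.
by have [_ + _] := mem_subs hc; rewrite (leaves_inner2 lt).
Qed.

Lemma isum_total x : P x -> isum (0, n.+1)%N x = ('C(n.+2, 2))%:R.
Proof.
move=> Px; apply/le_anti; rewrite (@isum_ge (0, n.+1)%N) // andbT.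
apply: (associahedron_le (phi := isum (0, n.+1)%N)) Px => t lt.
rewrite /= (isum_loday_point_sub lt) //.
by move: lt; case: t => //= l r; rewrite !leaves_inner inE addSn addnS => -[->]; rewrite eqxx.
Qed.

(** The system is triangular: once the coordinates of both children vanish, the sum over the whole
    tree reduces to the coordinate of the root. *)
Lemma isum_injective t o x : (o + inner t <= n.+1)%N ->
  (forall c, c \in subs t o -> isum c x = 0) ->
  forall j, (o <= j < o + inner t)%N -> x 0 (inord j) = 0.
Proof.
elim: t o => [|l IHl r IHr] o /= ho h j; first by lia.
have hl : forall j, (o <= j < o + inner l)%N -> x 0 (inord j) = 0.
  by apply: IHl => [|c hc]; [lia | apply: h; rewrite inE mem_cat hc orbT].
have hr : forall j, (o + (inner l).+1 <= j < o + (inner l).+1 + inner r)%N ->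
    x 0 (inord j) = 0.
  by apply: IHr => [|c hc]; [lia | apply: h; rewrite inE mem_cat hc !orbT].
have := h (o, (inner l + inner r).+1) (mem_head _ _); rewrite /isum /=.
rewrite (@big_cat_nat _ _ _ (o + inner l)) /=; try lia.
rewrite (@big_cat_nat _ _ _ (o + inner l).+1 (o + inner l)) /=; try lia.
rewrite big_nat_cond big1 => [|i]; last by rewrite andbT => /hl.
rewrite add0r big_nat1 big_nat_cond big1 => [|i]; last first.
  by rewrite andbT => hi; apply: hr; lia.
rewrite addr0 => h0 hj.
have [/hl //|[-> //|/hr //]] : (o <= j < o + inner l)%N \/ j = (o + inner l)%N \/
  (o + (inner l).+1 <= j < o + (inner l).+1 + inner r)%N by lia.
Qed.

Lemma isum_eq t x y : leaves t = n.+2 ->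
  (forall c, c \in subs t 0 -> isum c x = isum c y) -> x = y.
Proof.
move=> lt h; apply/eqP; rewrite -subr_eq0; apply/eqP/rowP => i; rewrite [RHS]mxE.
rewrite -[i]inord_val; apply: (@isum_injective t 0);
  rewrite ?(leaves_inner2 lt) ?leq0n ?add0n ?ltn_ord //.
by move=> c hc; rewrite linearB /= h ?subrr.
Qed.

Definition tight_face (N : seq (nat * nat)) : set V :=
  [set x | P x /\ forall c, c \in N -> isum c x = ('C(c.2.+1, 2))%:R].

Lemma tight_faceP N t : leaves t = n.+2 -> {subset N <= subs t 0} ->
  face P (tight_face N) /\ tight_face N (pt t).
Proof.
move=> lt Nt.
have ttight : tight_face N (pt t).
  split; first exact: loday_point_mem.
  by move=> c /Nt; apply: isum_loday_point_sub.
split=> //; split; first by exists (pt t).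
have cn c : c \in N -> (c.1 + c.2 <= n.+1)%N.
  by move=> /Nt /mem_subs[_ + _]; rewrite (leaves_inner2 lt).
exists (neg_isums N); apply/seteqP; split=> x [Px hx]; split=> //.
  move=> y Py; rewrite lerN2 !big_seq; apply: ler_sum => c cN.
  by rewrite hx //; apply: isum_ge; first exact: cn.
(* A maximizer has total slack at most that of [pt t], which is zero; slacks are nonnegative, so
   each one vanishes. *)
have := hx _ (loday_point_mem lt); rewrite lerN2 -subr_ge0 -sumrB => hle.
have hge c : c \in N -> isum c (pt t) <= isum c x.
  by move=> cN; rewrite (isum_loday_point_sub lt) ?Nt //; apply: isum_ge (cn _ cN) Px.
have : \sum_(c <- N) (isum c x - isum c (pt t)) == 0.
  apply/eqP/le_anti; rewrite -oppr_ge0 -sumrN.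
  under eq_bigr do rewrite opprB.
  by rewrite hle big_seq sumr_ge0 // => c cN; rewrite subr_ge0 hge.
rewrite big_seq psumr_eq0 => [/allP h0 c cN|c cN]; last by rewrite subr_ge0 hge.
have := h0 _ cN; rewrite cN /= subr_eq0 => /eqP ->.
by rewrite (isum_loday_point_sub lt) ?Nt.
Qed.

Lemma vertex_loday_point t : leaves t = n.+2 -> vertex P (pt t).
Proof.
move=> lt; have [hf [Pt ht]] := @tight_faceP (subs t 0) t lt (fun c h => h).
rewrite /vertex (_ : [set pt t] = tight_face (subs t 0)) //.
apply/seteqP; split=> [x -> //|x [Px hx]].
by apply: (@isum_eq t) => // c hc; rewrite hx // ht.
Qed.

Lemma finite_loday_points : finite_set [set pt t | t in [set t | leaves t = n.+2]].
Proof.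
apply: finite_image; apply: (@sub_finite_set _ _ [set t | (inner t <= n.+1)%N]).
  by move=> t /= /leaves_inner2 ->.
elim: n.+1 => [|k IH].
  by apply: (@sub_finite_set _ _ [set Leaf]) => //; case.
apply: (@sub_finite_set _ _ ([set Leaf] `|`
    [set Node lr.1 lr.2 | lr in [set t | (inner t <= k)%N] `*` [set t | (inner t <= k)%N]])).
  case=> [_|l r /=]; first by left.
  by move=> h; right; exists (l, r) => //; split => /=; lia.
by rewrite finite_setU; split=> //; apply: finite_image; apply: finite_setX.
Qed.

(** Only weak bounds pass to the convex hull, so a strict bound on the generators is first improved
    to a smaller constant. *)
Lemma finite_lt_bound (A : set V) (phi : V -> R) b : finite_set A ->
  (forall x, A x -> phi x < b) -> exists2 a, a < b & forall x, A x -> phi x <= a.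
Proof.
move=> /finite_seqP[s ->]; elim: s => [|y s IH] h.
  by exists (b - 1); rewrite ?ltrBlDr ?ltrDl ?ltr01.
have [x /= xs|a ab ha] := IH; first by apply: h; rewrite /= inE xs orbT.
exists (Num.max (phi y) a); first by rewrite gt_max ab h //= mem_head.
by move=> x /=; rewrite inE => /orP[/eqP ->|/ha h']; rewrite le_max ?lexx ?h' ?orbT.
Qed.

(** If no generator attained the maximum of the functional, finiteness would bound the whole hull
    strictly below it. *)
Lemma face_loday_point F : face P F -> exists2 t, leaves t = n.+2 & F (pt t).
Proof.
move=> [[x Fx] [phi FE]]; apply: contrapT => noF.
have := Fx; rewrite FE /= => -[Px xmax].
have lt_max y : [set pt t | t in [set t | leaves t = n.+2]] y -> phi y < phi x.
  move=> [t lt <-]; rewrite lt_neqAle xmax ?andbT; last exact: loday_point_mem.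
  apply/negP => /eqP E; apply: noF; exists t => //; rewrite FE; split.
    exact: loday_point_mem.
  by rewrite E.
have [a ax ha] := finite_lt_bound finite_loday_points lt_max.
have : phi x <= a by apply: associahedron_le Px => t lt; apply: ha; exists t.
by rewrite leNgt ax.
Qed.

Lemma vertexP v : vertex P v -> exists2 t, leaves t = n.+2 & v = pt t.
Proof. by move=> /face_loday_point[t lt <-]; exists t. Qed.

End Geometry.

(** * The cone of the associahedron at a vertex *)

Definition all_kids (t : bintree) : seq (nat * nat) :=
  kids true t 0 ++ kids false t 0.

(** [nb c] is the rotation of [t] that destroys the non-root subtree [c]; other values are
    arbitrary. *)
Definition neighbour_map (t : bintree) (nb : nat * nat -> bintree) : Prop :=
  forall b c, c \in kids b t 0 -> rotation b t (nb c) /\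
    forall c', c' != c -> c' \in subs t 0 -> c' \in subs (nb c) 0.

Lemma mem_all_kids t c : c \in all_kids t -> exists b, c \in kids b t 0.
Proof. by rewrite mem_cat => /orP[]; [exists true | exists false]. Qed.

Lemma all_kids_mem b t c : c \in kids b t 0 -> c \in all_kids t.
Proof. by rewrite mem_cat; case: b => ->; rewrite ?orbT. Qed.

Lemma all_kids_subs t c : c \in all_kids t -> c \in subs t 0.
Proof. by rewrite (perm_mem (perm_subs t 0)) [in X in _ -> X]mem_cat => ->; rewrite orbT. Qed.

Lemma uniq_all_kids t : uniq (all_kids t).
Proof.
by have := uniq_subs t 0; rewrite (perm_uniq (perm_subs t 0)) cat_uniq => /and3P[].
Qed.

Lemma exists_neighbour_map t : exists nb, neighbour_map t nb.
Proof.
have [|nb hnb] := @choice (nat * nat)%type bintree (fun c u => forall b, c \in kids b t 0 ->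
  rotation b t u /\ forall c', c' != c -> c' \in subs t 0 -> c' \in subs u 0); last first.
  by exists nb => b c; apply: hnb.
move=> c; have [hT|hT] := boolP (c \in kids true t 0).
  have [u tu hu] := kid_rotation hT; exists u => -[_|hF]; first by split.
  (* No subtree is both a left and a right child, so the direction is determined by [c]. *)
  have := uniq_all_kids t; rewrite cat_uniq => /and3P[_ /hasP[]].
  by exists c.
have [hF|hF] := boolP (c \in kids false t 0).
  have [u tu hu] := kid_rotation hF; exists u => -[|_]; last by split.
  by rewrite (negPf hT).
by exists Leaf => -[] h; rewrite h in hT hF.
Qed.

Section Cone.
Variables (R : realType) (n : nat) (t : bintree) (nb : nat * nat -> bintree).
Hypotheses (lt : leaves t = n.+2) (nbP : neighbour_map t nb).
Implicit Types (c : nat * nat) (x : 'rV[R]_n.+1) (F : set 'rV[R]_n.+1).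
Local Notation V := 'rV[R]_n.+1.
Local Notation P := (associahedron R n).
Local Notation pt := (loday_point R n).
Local Notation cs := (all_kids t).

Lemma leaves_nb c : c \in cs -> leaves (nb c) = n.+2.
Proof. by move=> /mem_all_kids[b /nbP[/rotation_leaves -> _]]. Qed.

Lemma isum_nb c c' : c \in cs -> c' \in subs t 0 -> c' != c ->
  isum c' (pt (nb c)) = isum c' (pt t).
Proof.
move=> hc hc' nc; rewrite [RHS]isum_loday_point_sub // isum_loday_point_sub ?leaves_nb //.
by have [b /nbP[_ ->]] := mem_all_kids hc.
Qed.

Lemma subs_bound c : c \in subs t 0 -> (c.1 + c.2 <= n.+1)%N.
Proof. by move=> /mem_subs[_ + _]; rewrite (leaves_inner2 lt). Qed.

Lemma isum_ge_sub c x : c \in subs t 0 -> P x -> isum c (pt t) <= isum c x.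
Proof.
by move=> hc Px; rewrite isum_loday_point_sub //; apply: isum_ge (subs_bound hc) Px.
Qed.

Lemma rotation_neq b u v : rotation b u v -> u <> v.
Proof. by case: b => /right_rotation_weight + E; rewrite E ltnn. Qed.

(** With equality, [t] and [nb c] would agree on the interval sums of all subtrees of [t], hence
    coincide, although a rotation changes the weight. *)
Lemma isum_nb_gt c : c \in cs -> isum c (pt t) < isum c (pt (nb c)).
Proof.
move=> hc; rewrite lt_neqAle isum_ge_sub ?all_kids_subs //; last first.
  by apply: loday_point_mem; apply: leaves_nb.
rewrite andbT; apply/negP => /eqP E; have [b /nbP[/rotation_neq ne _]] := mem_all_kids hc.
apply: ne; apply: (@loday_point_inj R n) => //; first exact: leaves_nb.
apply: (@isum_eq _ _ t) => // c' hc'.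
by have [-> //|ne] := eqVneq c' c; rewrite isum_nb.
Qed.

(** The slack of [x] at [c], normalized to 1 at the neighbour [nb c]. *)
Definition coef c x : R :=
  (isum c x - isum c (pt t)) / (isum c (pt (nb c)) - isum c (pt t)).

Lemma coef_ge0 c x : c \in cs -> P x -> 0 <= coef c x.
Proof.
move=> hc Px; rewrite divr_ge0 // subr_ge0; first by rewrite isum_ge_sub ?all_kids_subs.
exact/ltW/isum_nb_gt.
Qed.

Lemma subs_root c : c \in subs t 0 -> c = (0%N, n.+1) \/ c \in cs.
Proof.
rewrite (perm_mem (perm_subs t 0)) mem_cat => /orP[h|]; [left|by right].
by move: h; rewrite -(leaves_inner2 lt); case: (t) => //= l r; rewrite inE => /eqP ->.
Qed.

(** Both sides have the same interval sums over the subtrees of [t]: the total is constant on the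
    polytope, and on any other subtree [c'] only the direction of [nb c'] is nonzero. *)
Lemma cone_decomposition x : P x ->
  x = pt t + \sum_(c <- cs) coef c x *: (pt (nb c) - pt t).
Proof.
move=> Px; apply: (@isum_eq _ _ t) => // c' hc'.
rewrite linearD linear_sum /=; have [->|c'k] := subs_root hc'.
  rewrite big_seq big1 => [|c hc].
    by rewrite addr0 !isum_total //; apply: loday_point_mem.
  rewrite linearZ linearB /= /GRing.scale /= !isum_total ?subrr ?mulr0 //.
    exact: loday_point_mem.
  by apply: loday_point_mem; apply: leaves_nb.
rewrite (bigD1_seq c') ?uniq_all_kids //= big_seq_cond big1 => [|c /andP[hc ne]].
  rewrite addr0 linearZ linearB /= /GRing.scale /= /coef divfK.
    by rewrite addrC subrK.
  by rewrite subr_eq0 gt_eqF // isum_nb_gt.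
by rewrite linearZ linearB /= /GRing.scale /= isum_nb ?subrr ?mulr0 // eq_sym.
Qed.

(** The functional is maximal at both [pt t] and [x], so the nonnegative losses along the cone
    directions sum to zero; a direction that [x] uses loses nothing. *)
Lemma face_cone F c x : face P F -> F (pt t) -> F x -> c \in cs ->
  coef c x != 0 -> F (pt (nb c)).
Proof.
move=> [_ [phi FE]] Ft Fx hc; move: Ft Fx; rewrite FE => -[Pt tmax] [Px xmax].
have pnb c' : c' \in cs -> P (pt (nb c')) by move=> h; apply: loday_point_mem; apply: leaves_nb.
have term c' : c' \in cs -> 0 <= coef c' x * (phi (pt t) - phi (pt (nb c'))).
  by move=> h; rewrite mulr_ge0 ?coef_ge0 // subr_ge0 tmax //; apply: pnb.
have : \sum_(c' <- cs) coef c' x * (phi (pt t) - phi (pt (nb c'))) == 0.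
  have /(congr1 phi) := cone_decomposition Px; rewrite linearD linear_sum /=.
  have -> : phi x = phi (pt t) by apply/le_anti; rewrite tmax // xmax.
  move/eqP; rewrite -subr_eq0 opprD addNKr oppr_eq0 => /eqP E.
  rewrite -oppr_eq0 -sumrN -[X in _ == X]E; apply/eqP/eq_bigr => c' _.
  by rewrite [RHS]linearZ [in RHS]linearB /= -mulrN opprB.
rewrite big_seq psumr_eq0 // => /allP/(_ _ hc); rewrite hc mulf_eq0 => /orP[/eqP ->|].
  by rewrite eqxx.
rewrite subr_eq0 => /eqP E _; split; first exact: pnb.
by move=> y Py; rewrite -E tmax.
Qed.

Definition face_kids F := [seq c <- cs | `[< F (pt (nb c)) >]].

Lemma face_kids_decomposition F x : face P F -> F (pt t) -> F x ->
  x = pt t + \sum_(c <- face_kids F) coef c x *: (pt (nb c) - pt t).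
Proof.
move=> Fface Ft Fx; have Px : P x by move: Fface Fx => [_ [phi ->]] [].
rewrite {1}[x]cone_decomposition //; congr (_ + _).
rewrite big_filter [RHS]big_mkcond; apply: eq_big_seq => c hc /=.
case: asboolP => // nF; have [->|/(face_cone Fface Ft Fx hc) //] := eqVneq (coef c x) 0.
by rewrite scale0r.
Qed.

(** The directions to the neighbours in [F] span by the decomposition, and they are independent
    because [isum c] vanishes on all of them except that of [nb c]. *)
Lemma affine_dim_face F : face P F -> F (pt t) -> affine_dim F = size (face_kids F).
Proof.
move=> Fface Ft; set s := face_kids F; set c0 := (0%N, 0%N).
have sub_s c : c \in s -> c \in cs by rewrite mem_filter => /andP[].
have F_s c : c \in s -> F (pt (nb c)) by rewrite mem_filter => /andP[/asboolP].
have us : uniq s by rewrite filter_uniq ?uniq_all_kids.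
pose D := \matrix_(i < size s) (pt (nb (nth c0 s i)) - pt t).
apply/eqP; rewrite eqn_leq; apply/andP; split.
  apply: (@affine_dim_le _ _ _ _ D (pt t)) => x Fx.
  rewrite {1}[x](face_kids_decomposition Fface Ft) // addrC addKr big_seq.
  apply: summx_sub => c cs'; apply: scalemx_sub.
  have ci : (index c s < size s)%N by rewrite index_mem.
  rewrite (_ : _ - _ = row (Ordinal ci) D) ?row_sub //.
  by rewrite rowK /= nth_index.
pose x (i : 'I_(size s).+1) :=
  if unlift ord0 i is Some j then pt (nb (nth c0 s j)) else pt t.
apply: (@affine_dim_ge _ _ _ _ x) => [i|].
  by rewrite /x; case: unliftP => // j _; apply/F_s/mem_nth.
rewrite /affinely_independent (_ : \matrix_i _ = D); last first.
  by apply/row_matrixP => i; rewrite !rowK /x liftK unlift_none.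
apply: inj_row_free => v /(congr1 (fun y => y + pt t)); rewrite add0r => E.
apply/rowP => j; rewrite [RHS]mxE; have hj : nth c0 s j \in s by rewrite mem_nth.
have := congr1 (isum (nth c0 s j)) E; rewrite mulmx_sum_row linearD linear_sum /=.
rewrite (bigD1 j) //= big1 => [|i ij]; last first.
  rewrite linearZ /= rowK linearB /= /GRing.scale /= isum_nb ?subrr ?mulr0 //.
  - by apply/sub_s/mem_nth.
  - exact/all_kids_subs/sub_s.
  - by rewrite nth_uniq // eq_sym.
rewrite addr0 => /eqP; rewrite -subr_eq0 addrK linearZ /= rowK linearB /=.
rewrite /GRing.scale /= mulf_eq0.
by rewrite orbC subr_eq0 gt_eqF ?isum_nb_gt ?sub_s //= => /eqP.
Qed.

End Cone.

(** * Faces and the Tamari order *)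

Fixpoint left_comb (k : nat) : bintree :=
  if k is k'.+1 then Node (left_comb k') Leaf else Leaf.

Lemma leaves_left_comb k : leaves (left_comb k) = k.+1.
Proof. by elim: k => //= k ->; rewrite addn1. Qed.

Lemma size_all_kids n t : leaves t = n.+2 -> size (all_kids t) = n.
Proof.
move=> /leaves_inner2 lt; have := size_kids t 0; rewrite lt size_cat.
by case: (t) lt => //= l r _ [->].
Qed.

Lemma clos_rt_rotation_false t u :
  clos_refl_trans _ (rotation false) t u -> tamari_le u t.
Proof.
elim=> [v w vw|v|u' v w _ h1 _ h2]; [exact: rt_step|exact: rt_refl|].
exact: rt_trans h2 h1.
Qed.

Section Faces.
Variables (R : realType) (n : nat).
Implicit Types (t u : bintree) (c : nat * nat) (x : 'rV[R]_n.+1) (F : set 'rV[R]_n.+1).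
Local Notation V := 'rV[R]_n.+1.
Local Notation P := (associahedron R n).
Local Notation pt := (loday_point R n).

Definition signed_height (b : bool) x : R := if b then height x else - height x.

Lemma rotation_height b t u : leaves t = n.+2 -> rotation b t u ->
  signed_height b (pt t) + 1 <= signed_height b (pt u).
Proof.
move=> lt tu; have lu := rotation_leaves tu; rewrite lt in lu.
case: b tu => /= /right_rotation_weight; rewrite !height_loday_point // ?opprK;
  by rewrite -(ler_nat R) -natr1; lra.
Qed.

(** For [t] in [F] this is the local form of being the top ([b = true]) or bottom ([b = false])
    vertex. *)
Definition no_rotation (b : bool) F t := forall u, rotation b t u -> ~ F (pt u).

Lemma face_kids_no_rotation b F t nb c : neighbour_map t nb -> no_rotation b F t ->
  c \in face_kids t nb F -> c \in kids (~~ b) t 0.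
Proof.
move=> nbP noF; rewrite mem_filter => /andP[/asboolP Fc /mem_all_kids[b' hc]].
have [rot _] := nbP _ _ hc; case: (b =P b') => [E|]; last by case: b b' hc {noF rot} => -[].
by case: (noF (nb c)) => //; rewrite E.
Qed.

(** All cone directions that stay in [F] are rotations against [b], which lower the signed height;
    [x] is a nonnegative combination of them. *)
Lemma face_height b F t x : leaves t = n.+2 -> face P F -> F (pt t) ->
  no_rotation b F t -> F x ->
  x = pt t \/ signed_height b x < signed_height b (pt t).
Proof.
move=> lt Ff Ft noF Fx; have [nb nbP] := exists_neighbour_map t.
have Px : P x by move: Ff Fx => [_ [phi ->]] [].
have E := face_kids_decomposition lt nbP Ff Ft Fx.
set s := face_kids t nb F in E.
have s_cs c : c \in s -> c \in all_kids t by rewrite mem_filter => /andP[].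
have s_lt c : c \in s -> signed_height b (pt (nb c)) < signed_height b (pt t).
  move=> hc; have [+ _] := nbP _ _ (face_kids_no_rotation nbP noF hc).
  by move=> /(rotation_height lt); rewrite /signed_height; case: (b) => /=; lra.
have term c : c \in s ->
    0 <= coef t nb c x * (signed_height b (pt t) - signed_height b (pt (nb c))).
  move=> hc; apply: mulr_ge0; first by rewrite coef_ge0 ?s_cs.
  by rewrite subr_ge0 ltW ?s_lt.
have Eh : signed_height b (pt t) - signed_height b x =
    \sum_(c <- s) coef t nb c x * (signed_height b (pt t) - signed_height b (pt (nb c))).
  have -> : signed_height b (pt t) - signed_height b x = - signed_height b (x - pt t).
    by rewrite /signed_height linearB /=; case: (b) => /=; ring.
  rewrite {1}E addrC addKr /signed_height linear_sum -sumrN /=.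
  case: (b); rewrite -?sumrN; apply: eq_bigr => c _;
    by rewrite linearZ linearB /= /GRing.scale /=; ring.
have : 0 <= signed_height b (pt t) - signed_height b x.
  by rewrite Eh big_seq sumr_ge0.
rewrite le_eqVlt subr_gt0 => /orP[|->]; last by right.
rewrite eq_sym Eh big_seq psumr_eq0 // => /allP h; left.
rewrite E big_seq big1 ?addr0 // => c hc; have := h _ hc.
rewrite hc mulf_eq0 orbC subr_eq0 gt_eqF ?s_lt //= => /eqP ->.
by rewrite scale0r.
Qed.

(* The simplex method: rotating within the face as long as possible can only
   stop at t. *)
Lemma face_clos_rt b F t u : leaves t = n.+2 -> leaves u = n.+2 -> face P F ->
  F (pt t) -> F (pt u) -> no_rotation b F t -> clos_refl_trans _ (rotation b) u t.
Proof.
move=> lt lu Ff Ft Fu noF.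
(* Each rotation gains at least 1 in signed height, so [k] bounds the number of rotations. *)
have [k hk] : exists k, signed_height b (pt t) - signed_height b (pt u) < k%:R.
  eexists; apply: le_lt_trans (ler_norm _) _; exact: archi_boundP.
elim: k => [|k IH] in u lu Fu hk *.
  have [E|] := face_height lt Ff Ft noF Fu; last by lra.
  by rewrite (loday_point_inj lu lt E); apply: rt_refl.
have [[v [uv Fv]]|nov] := pselect (exists v, rotation b u v /\ F (pt v)).
  have lv := rotation_leaves uv; rewrite lu in lv.
  apply: rt_trans (rt_step _ _ _ _ uv) _; apply: IH => //.
  by have := rotation_height lu uv; move: hk; rewrite -natr1; lra.
have nou : no_rotation b F u by move=> v uv Fv; apply: nov; exists v.
have [E|] := face_height lt Ff Ft noF Fu.
  by rewrite (loday_point_inj lu lt E); apply: rt_refl.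
(* Now [t] and [u] are both locally extremal; if distinct, each would be strictly higher than the
   other. *)
have [E|] := face_height lu Ff Fu nou Ft; last by lra.
by rewrite (loday_point_inj lt lu E); lra.
Qed.

Lemma face_tamari_bottom F t u : leaves t = n.+2 -> leaves u = n.+2 -> face P F ->
  F (pt t) -> F (pt u) -> no_rotation false F t -> tamari_le t u.
Proof.
by move=> lt lu Ff Ft Fu noF; apply: clos_rt_rotation_false (face_clos_rt lt lu Ff Ft Fu noF).
Qed.

Lemma face_tamari_top F t u : leaves t = n.+2 -> leaves u = n.+2 -> face P F ->
  F (pt t) -> F (pt u) -> no_rotation true F t -> tamari_le u t.
Proof. by move=> lt lu Ff Ft Fu noF; exact: (face_clos_rt lt lu Ff Ft Fu noF). Qed.

Lemma affine_dim_no_rotation b F t : leaves t = n.+2 -> face P F -> F (pt t) ->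
  no_rotation b F t -> (affine_dim F <= size (kids (~~ b) t 0))%N.
Proof.
move=> lt Ff Ft noF; have [nb nbP] := exists_neighbour_map t.
rewrite (affine_dim_face lt nbP Ff Ft); apply: uniq_leq_size.
  by rewrite filter_uniq ?uniq_all_kids.
by move=> c; apply: face_kids_no_rotation.
Qed.

(** Destroying [c] makes its inequality strict and leaves the inequalities of all other subtrees
    tight. *)
Lemma tight_face_neighbour N t nb c : leaves t = n.+2 -> neighbour_map t nb ->
  {subset N <= subs t 0} -> c \in all_kids t ->
  @tight_face R n N (pt (nb c)) <-> c \notin N.
Proof.
move=> lt nbP Nt hc; split=> [[_ h]|cN].
  apply/negP => /h; rewrite -(isum_loday_point_sub R lt) ?all_kids_subs //.
  by move/eqP; rewrite gt_eqF // isum_nb_gt.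
split; first by apply: loday_point_mem; apply: leaves_nb hc.
move=> c' c'N; have ne : c' != c by apply: contraNneq cN => <-.
by rewrite (isum_nb R lt nbP hc) ?Nt // (isum_loday_point_sub R lt) ?Nt.
Qed.

Lemma affine_dim_tight_face N t : leaves t = n.+2 -> {subset N <= subs t 0} ->
  affine_dim (@tight_face R n N) = count (fun c => c \notin N) (all_kids t).
Proof.
move=> lt Nt; have [nb nbP] := exists_neighbour_map t.
have [Ff Ft] := tight_faceP R lt Nt.
rewrite (affine_dim_face lt nbP Ff Ft) size_filter; apply: eq_in_count => c hc.
by apply/asboolP/idP => /(tight_face_neighbour lt nbP Nt hc).
Qed.

Lemma tight_face_nil : @tight_face R n [::] = P.
Proof. by apply/seteqP; split=> x // [Px]. Qed.

Lemma affine_dim_associahedron : affine_dim P = n.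
Proof.
rewrite -tight_face_nil (@affine_dim_tight_face _ (left_comb n.+1)) ?leaves_left_comb //.
by rewrite count_predT (@size_all_kids n) ?leaves_left_comb.
Qed.

(** If all n neighbours of a vertex of [F] lay in [F], the functional would be constant on the cone,
    hence on the polytope. *)
Lemma affine_dim_proper_face F : face P F -> F <> P -> (affine_dim F < n)%N.
Proof.
move=> Ff FP; have [t lt Ft] := face_loday_point Ff.
have [nb nbP] := exists_neighbour_map t.
rewrite (affine_dim_face lt nbP Ff Ft) size_filter ltn_neqAle.
rewrite -[in X in (_ <= X)%N](size_all_kids lt) count_size andbT.
apply/negP => /eqP; rewrite -[in RHS](size_all_kids lt) => /eqP; rewrite -all_count => /allP hall.
apply: FP; apply/seteqP; split=> [x|x Px]; first by move: Ff => [_ [phi ->]] [].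
have Fnb c : c \in all_kids t -> F (pt (nb c)) by move=> /hall /asboolP.
move: Ff Ft Fnb => [_ [phi ->]] [Pt tmax] Fnb; split=> // y Py.
suff -> : phi x = phi (pt t) by exact: tmax.
rewrite {1}(cone_decomposition lt nbP Px) linearD linear_sum /= big_seq big1 ?addr0 //.
move=> c hc; have [Pc cmax] := Fnb _ hc.
have -> : phi (coef t nb c x *: (pt (nb c) - pt t)) =
    coef t nb c x *: (phi (pt (nb c)) - phi (pt t)) by rewrite linearZ linearB.
have -> : phi (pt (nb c)) = phi (pt t) by apply/le_anti; rewrite tmax ?cmax.
by rewrite subrr scaler0.
Qed.

Lemma exists_facet : (0 < n)%N ->
  exists F, [/\ face P F, F <> P & (affine_dim F).+1 = n].
Proof.
move=> n0; have lt : leaves (left_comb n.+1) = n.+2 by exact: leaves_left_comb.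
set t := left_comb n.+1 in lt.
have sz := size_all_kids lt.
have [c hc] : exists c, c \in all_kids t.
  by case: (all_kids t) sz n0 => [<-|c s _ _] //; exists c; rewrite mem_head.
have ct : {subset [:: c] <= subs t 0}.
  by move=> c'; rewrite inE => /eqP ->; apply: all_kids_subs.
have dimF : (affine_dim (@tight_face R n [:: c])).+1 = n.
  rewrite (affine_dim_tight_face lt ct) -[RHS]sz -(count_predC (pred1 c)).
  rewrite count_uniq_mem ?uniq_all_kids // hc add1n; congr _.+1.
  by apply: eq_count => c' /=; rewrite inE.
exists (@tight_face R n [:: c]); split=> //; first by have [] := tight_faceP R lt ct.
by move=> E; move: dimF; rewrite E affine_dim_associahedron; lia.
Qed.

(** The edge is cut out by the subtrees of [t] that survive in [u]; only the destroyed one is left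
    free. *)
Lemma rotation_edge t u : leaves t = n.+2 -> right_rotation t u ->
  exists E, [/\ edge P E, E (pt t) & E (pt u)].
Proof.
move=> lt tu; have [c hc hu] := rotation_kid 0 (tu : rotation true t u).
pose N := [seq c' <- subs t 0 | c' != c].
have Nt : {subset N <= subs t 0} by move=> c'; rewrite mem_filter => /andP[].
have Nu : {subset N <= subs u 0} by move=> c'; rewrite mem_filter => /andP[/hu].
have lu := rotation_leaves (tu : rotation true t u); rewrite lt in lu.
have [Ff Ft] := tight_faceP R lt Nt; have [_ Fu] := tight_faceP R lu Nu.
exists (@tight_face R n N); split=> //; split=> //.
rewrite (affine_dim_tight_face lt Nt) -(_ : nat_of_bool (c \in all_kids t) = 1%N); last first.
  by rewrite (@all_kids_mem true).
rewrite -count_uniq_mem ?uniq_all_kids //; apply: eq_in_count => c' hc' /=.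
by rewrite mem_filter all_kids_subs // andbT negbK.
Qed.

Lemma edge_neighbour E t : leaves t = n.+2 -> edge P E -> E (pt t) ->
  exists b u, [/\ rotation b t u, E (pt u) & forall x, E x ->
    exists2 a, 0 <= a & x = pt t + a *: (pt u - pt t)].
Proof.
move=> lt [Ff dimE] Et; have [nb nbP] := exists_neighbour_map t.
have := affine_dim_face lt nbP Ff Et; rewrite dimE.
case Es : (face_kids t nb E) => [|c [|]] // _.
have : c \in face_kids t nb E by rewrite Es mem_head.
rewrite mem_filter => /andP[/asboolP Ec hc]; have [b hb] := mem_all_kids hc.
have [rot _] := nbP _ _ hb; exists b, (nb c); split=> // x Ex.
exists (coef t nb c x).
  by rewrite coef_ge0 //; move: Ff Ex => [_ [phi ->]] [].
by rewrite {1}(face_kids_decomposition lt nbP Ff Et Ex) Es big_seq1.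
Qed.

Lemma edge_height E : edge P E -> exists x y, [/\ E x, E y & height x != height y].
Proof.
move=> Ee; have [t lt Et] := face_loday_point Ee.1.
have [b [u [tu Eu _]]] := edge_neighbour lt Ee Et.
exists (pt t), (pt u); split=> //; have := rotation_height lt tu.
by apply: contraTneq => E'; rewrite /signed_height E'; case: b {tu}; rewrite -ltNge; lra.
Qed.

Lemma edge_tamari E t u : leaves t = n.+2 -> leaves u = n.+2 -> edge P E ->
  E (pt t) -> E (pt u) -> height (pt t) < height (pt u) -> tamari_le t u.
Proof.
move=> lt lu Ee Et Eu htu; have [b [v [tv Ev hE]]] := edge_neighbour lt Ee Et.
have hgt x a : x = pt t + a *: (pt v - pt t) ->
    height x - height (pt t) = a * (height (pt v) - height (pt t)).
  by move=> ->; rewrite linearD linearZ linearB /= /GRing.scale /=; ring.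
have htv : height (pt t) < height (pt v).
  have [a a0 /hgt E1] := hE _ Eu; rewrite -subr_gt0.
  move: htu; rewrite -subr_gt0 E1 => had; rewrite ltNge; apply/negP => d0.
  by have := mulr_ge0_le0 a0 d0; rewrite leNgt had.
(* The edge is a segment of an ascending ray from [pt t], so it contains no downward rotation of
   [t]. *)
apply: (face_tamari_bottom lt lu Ee.1 Et Eu) => w tw /hE[a a0 /hgt E1].
have := rotation_height lt tw; rewrite /signed_height /=.
have : 0 <= a * (height (pt v) - height (pt t)) by rewrite mulr_ge0 // subr_ge0 ltW.
by rewrite -E1; lra.
Qed.

End Faces.

(** * An oriented family that induces the Tamari order *)

Section Family.
Variable (R : realType).

Lemma associahedron_polytope n : convex_polytope (associahedron R n).
Proof.
exists [set loday_point R n t | t in [set t | leaves t = n.+2]]; split=> //.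
  exact: finite_loday_points.
exists (loday_point R n (left_comb n.+1)), (left_comb n.+1) => //.
exact: leaves_left_comb.
Qed.

Definition tamari_family : polytope_family R S := fun n =>
  OrientedPolytope (@associahedron_polytope n) (@edge_height R n).

Lemma tamari_familyP : tamari_associahedra tamari_family.
Proof.
move=> n _; split=> // t u lt lu; split; last first.
  move=> tu; elim: tu lt lu => [v w vw|v|v w x vw h1 _ h2] lv lw.
  - apply: rt_step; split; rewrite ?vertex_loday_point //; try exact: vertex_loday_point.
      exact: rotation_edge.
    by have := rotation_height R lv (vw : rotation true v w); rewrite /signed_height /=; lra.
  - exact: rt_refl.
  - have l : leaves w = n.+2.
      rewrite -lv; elim: vw => // [y z yz|a y z _ e1 _ e2]; last by rewrite e2.
      exact: (rotation_leaves (yz : rotation true y z)).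
    by apply: rt_trans (h1 _ _) (h2 _ _).
(* Stated for arbitrary vectors so that induction on the path applies; its intermediate points are
   vertices, hence Loday points. *)
have main x y : vertex_le (tamari_family n) x y -> forall v, leaves v = n.+2 ->
    x = loday_point R n v ->
    exists w, [/\ leaves w = n.+2, y = loday_point R n w & tamari_le v w].
  elim=> {x y} [x y [_ /vertexP[w lw ->] [E [Ee Ex Ey]] hxy] v lv xv
    |x v lv ->|x y z _ h1 _ h2 v lv].
  - exists w; split=> //; subst x; exact: (edge_tamari lv lw Ee Ex Ey hxy).
  - by exists v; split=> //; apply: rt_refl.
  - move=> /(h1 _ lv)[w [lw /(h2 _ lw)[w' [lw' -> ww']] vw]].
    by exists w'; split=> //; apply: rt_trans vw ww'.
move=> /main/(_ _ lt erefl)[w [lw /(loday_point_inj lu lw) -> //]].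
Qed.

End Family.

(** * A chain of cubes *)

(* Trees whose inner vertices form a path from the root; [true] means that the
   path turns right. *)
Fixpoint spine (w : seq bool) : bintree :=
  match w with
  | [::] => Node Leaf Leaf
  | true :: w' => Node Leaf (spine w')
  | false :: w' => Node (spine w') Leaf
  end.

(* A sequence over {false, true, *} (with [None] for [*]) describes a cubical
   face: each [*] stands for a ternary vertex whose middle child continues the
   path, resolved as [false; true] at the bottom vertex of the cube and as
   [true; false] at its top vertex. *)
Fixpoint resolve (b : bool) (s : seq (option bool)) : seq bool :=
  match s with
  | [::] => [::]
  | Some x :: s' => x :: resolve b s'
  | None :: s' => b :: ~~ b :: resolve b s'
  end.

Definition stars (s : seq (option bool)) : nat := count (pred1 None) s.

(** The path subtrees common to both resolutions. A star contributes only its upper vertex: the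
    lower one depends on the resolution, while the middle child always starts one inner vertex
    further right. *)
Fixpoint cube_subs (s : seq (option bool)) (o : nat) : seq (nat * nat) :=
  let m := (size s + stars s).+1 in
  match s with
  | [::] => [:: (o, m)]
  | Some false :: s' => (o, m) :: cube_subs s' o
  | _ :: s' => (o, m) :: cube_subs s' o.+1
  end.

Lemma size_resolve b s : size (resolve b s) = (size s + stars s)%N.
Proof. by rewrite /stars; elim: s => [|[x|] s IH] //=; rewrite IH /=; lia. Qed.

Lemma inner_spine w : inner (spine w) = (size w).+1.
Proof. by elim: w => [|[] w IH] //=; rewrite IH; lia. Qed.

Lemma size_cube_subs s o : size (cube_subs s o) = (size s).+1.
Proof. by elim: s o => [|[[]|] s IH] o //=; rewrite IH. Qed.

Lemma root_cube_subs b s o :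
  root_sub (spine (resolve b s)) o = [:: (o, (size s + stars s).+1)].
Proof.
rewrite -(size_resolve b) -inner_spine.
by case: (resolve b s) => [|[] w].
Qed.

Lemma head_cube_subs s o : (o, (size s + stars s).+1) \in cube_subs s o.
Proof. by case: s => [|[[]|] s]; rewrite mem_head. Qed.

Lemma cube_subs_sub b s o c :
  c \in cube_subs s o -> c \in subs (spine (resolve b s)) o.
Proof.
elim: s o => [|x s IH] o; first by rewrite /= !inE.
have E : inner (spine (resolve b s)) = (size s + stars s).+1.
  by rewrite inner_spine size_resolve.
case: x => [[]|]; rewrite /= inE.
- rewrite /stars /= !add0n E /stars addn1.
  by case/orP => [/eqP ->|/IH h]; rewrite inE ?eqxx // h orbT.
- rewrite /stars /= !add0n !addn0 E /stars.
  by case/orP => [/eqP ->|/IH h]; rewrite inE ?eqxx // mem_cat h orbT.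
- rewrite /stars /=; case: b E IH => /= E IH; rewrite !E /stars /=.
    case/orP => [/eqP ->|/IH h]; rewrite inE.
      by apply/orP; left; apply/eqP; congr pair; lia.
    by rewrite inE mem_cat addn1 h !orbT.
  case/orP => [/eqP ->|/IH h]; rewrite inE.
    by apply/orP; left; apply/eqP; congr pair; lia.
  by rewrite cats0 inE addn1 h !orbT.
Qed.

(** The lower vertex of a star resolved by [b] is a child on the side counted by [kids (~~ b)], so
    [kids b] meets only the common subtrees. *)
Lemma kids_cube_subs b s o c :
  c \in kids b (spine (resolve b s)) o -> c \in cube_subs s o.
Proof.
elim: s o => [|x s IH] o; first by case: b.
case: x => [[]|] /=.
- rewrite addn1 inE; case: b IH => IH /=; rewrite ?mem_cat.
    by move=> /IH ->; rewrite orbT.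
  rewrite root_cube_subs inE => /orP[/eqP ->|/IH ->]; last by rewrite orbT.
  by rewrite head_cube_subs orbT.
- rewrite inE; case: b IH => IH /=; rewrite cats0.
    rewrite mem_cat root_cube_subs inE => /orP[/eqP ->|/IH ->]; last by rewrite orbT.
    by rewrite head_cube_subs orbT.
  by move=> /IH ->; rewrite orbT.
- case: b IH => IH /=; rewrite ?cats0 addn1 inE.
    rewrite mem_cat root_cube_subs inE => /orP[/eqP ->|/IH ->]; last by rewrite orbT.
    by rewrite head_cube_subs orbT.
  rewrite mem_cat root_cube_subs inE => /orP[/eqP ->|/IH ->]; last by rewrite orbT.
  by rewrite head_cube_subs orbT.
Qed.

Section Cube.
Variables (R : realType) (n : nat).
Local Notation pt := (loday_point R n).

(** A rotation inside the face would keep even the inequality of the destroyed child tight, hence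
    would not move the point. *)
Lemma no_rotation_tight b N t : leaves t = n.+2 ->
  {subset N <= subs t 0} -> {subset kids b t 0 <= N} ->
  no_rotation b (@tight_face R n N) t.
Proof.
move=> lt Nt kN u tu [_ hu]; have [c /kN hc hs] := rotation_kid 0 tu.
have lu := rotation_leaves tu; rewrite lt in lu.
apply: (rotation_neq tu); apply: (@loday_point_inj R n) => //.
apply: (@isum_eq _ _ t) => // c' hc'.
have [->|ne] := eqVneq c' c; first by rewrite hu // isum_loday_point_sub ?Nt.
by rewrite !isum_loday_point_sub // hs.
Qed.

Definition cube s : set 'rV[R]_n.+1 := tight_face (cube_subs s 0).

Lemma leaves_spine b s : (size s + stars s)%N = n ->
  leaves (spine (resolve b s)) = n.+2.
Proof. by move=> sn; rewrite leaves_inner inner_spine size_resolve sn. Qed.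

Lemma cubeP b s : (size s + stars s)%N = n ->
  [/\ face (associahedron R n) (cube s), cube s (pt (spine (resolve b s))) &
      no_rotation b (cube s) (spine (resolve b s))].
Proof.
move=> sn; have lt := leaves_spine b sn.
have Nt : {subset cube_subs s 0 <= subs (spine (resolve b s)) 0}.
  by move=> c; apply: cube_subs_sub.
have [Ff Ft] := tight_faceP R lt Nt; split=> //.
by apply: no_rotation_tight => // c; apply: kids_cube_subs.
Qed.

(** Of the n + 1 subtrees at most [(size s).+1] are tight, which leaves at least [stars s] free
    directions. *)
Lemma affine_dim_cube s : (size s + stars s)%N = n ->
  (stars s <= affine_dim (cube s))%N.
Proof.
move=> sn; have lt := leaves_spine true sn; set t := spine _ in lt.
have Nt : {subset cube_subs s 0 <= subs t 0} by move=> c; apply: cube_subs_sub.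
rewrite (affine_dim_tight_face R lt Nt).
have sz := size_subs t 0; rewrite (leaves_inner2 lt) in sz.
have := count_predC (mem (cube_subs s 0)) (subs t 0); rewrite sz.
have h1 : (count (mem (cube_subs s 0)) (subs t 0) <= (size s).+1)%N.
  rewrite -(size_cube_subs s 0) -size_filter; apply: uniq_leq_size.
    by rewrite filter_uniq ?uniq_subs.
  by move=> c; rewrite mem_filter => /andP[].
have -> : count (predC (mem (cube_subs s 0))) (subs t 0) =
    count (fun c => c \notin cube_subs s 0) (all_kids t).
  rewrite (permP (perm_subs t 0)) count_cat root_cube_subs /= head_cube_subs.
  by rewrite add0n; apply: eq_count.
move=> E; rewrite -(leq_add2l (count (mem (cube_subs s 0)) (subs t 0))) [leqRHS]E -sn.
by rewrite -addSn leq_add2r.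
Qed.

End Cube.

Lemma resolve_cat b s1 s2 : resolve b (s1 ++ s2) = resolve b s1 ++ resolve b s2.
Proof. by elim: s1 => [|[x|] s1 IH] //=; rewrite IH. Qed.

Lemma resolve_nseq b x m : resolve b (nseq m (Some x)) = nseq m x.
Proof. by elim: m => //= m ->. Qed.

(** Regrouping (RL)^(m + 1) as R (LR)^m L trades one star for a letter R before and a letter L
    after, as from one cube to the next. *)
Lemma resolve_stars m w :
  resolve true (nseq m.+1 None) ++ w =
  true :: resolve false (nseq m None) ++ false :: w.
Proof. by elim: m => // m /= ->. Qed.

(* The i-th cube R^i *^(m - i) L^i of the chain, with one more letter R when n
   is odd.  Its top vertex R^i (RL)^(m - i) L^i is the bottom vertex of the
   next one. *)
Definition chain_word (n i : nat) : seq (option bool) :=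
  nseq (odd n + i) (Some true) ++ nseq (n./2 - i) None ++ nseq i (Some false).

Lemma stars_chain_word n i : stars (chain_word n i) = (n./2 - i)%N.
Proof. by rewrite /stars !count_cat !count_nseq /=; lia. Qed.

Lemma size_chain_word n i : (i <= n./2)%N ->
  (size (chain_word n i) + stars (chain_word n i))%N = n.
Proof. by move=> hi; rewrite stars_chain_word !size_cat !size_nseq; lia. Qed.

Lemma resolve_chain_word n i : (i < n./2)%N ->
  resolve true (chain_word n i) = resolve false (chain_word n i.+1).
Proof.
move=> hi; rewrite !resolve_cat !resolve_nseq -(subnSK hi) resolve_stars.
rewrite addnS -cat1s -[_ :: nseq i _]/(nseq i.+1 _) [in LHS]catA; congr (_ ++ _).
by rewrite cats1; elim: (odd n + i)%N => //= m ->.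
Qed.

(** * Excess of face chains *)

Lemma int_minimum (A : int -> Prop) (L : int) : (exists z, A z) ->
  (forall z, A z -> L <= z) -> exists e, A e /\ forall z, A z -> e <= z.
Proof.
move=> [z Az] LA.
have E y : A y -> L + (absz (y - L))%:Z = y by move=> /LA; lia.
have exA : exists m : nat, `[< A (L + m%:Z) >].
  by exists (absz (z - L)); apply/asboolP; rewrite E.
exists (L + (ex_minn exA)%:Z); case: ex_minnP => m /asboolP Am hm; split=> // y Ay.
have := hm (absz (y - L)); rewrite E // => /(_ (asboolT Ay)).
by have := E _ Ay; lia.
Qed.

Section Excess.
Variables (R : realType) (n : nat) (Q : oriented_polytope R n.+1).
Hypothesis QE : body Q = associahedron R n.
Hypothesis Q_tamari : forall t u, leaves t = n.+2 -> leaves u = n.+2 ->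
  vertex_le Q (loday_point R n t) (loday_point R n u) <-> tamari_le t u.
Implicit Types (F G : set 'rV[R]_n.+1) (t u : bintree).
Local Notation pt := (loday_point R n).
Local Notation nright t := (size (kids false t 0)).

Lemma vertexQ t : leaves t = n.+2 -> vertex Q (pt t).
Proof. by rewrite QE; apply: vertex_loday_point. Qed.

Lemma vertexQP v : vertex Q v -> exists2 t, leaves t = n.+2 & v = pt t.
Proof. by rewrite QE; apply: vertexP. Qed.

Lemma top_vertex_no_rotation F t : leaves t = n.+2 -> face Q F -> F (pt t) ->
  no_rotation true F t -> top_vertex Q F (pt t).
Proof.
move=> lt; rewrite QE => Ff Ft noF; split=> //; first exact: vertexQ.
move=> w /vertexQP[u lu ->] Fu; apply/Q_tamari => //.
exact: face_tamari_top Fu noF.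
Qed.

Lemma bottom_vertex_no_rotation F t : leaves t = n.+2 -> face Q F -> F (pt t) ->
  no_rotation false F t -> bottom_vertex Q F (pt t).
Proof.
move=> lt; rewrite QE => Ff Ft noF; split=> //; first exact: vertexQ.
move=> w /vertexQP[u lu ->] Fu; apply/Q_tamari => //.
exact: face_tamari_bottom Fu noF.
Qed.

Lemma tamari_le_antirotation t u : tamari_le t u -> ~ right_rotation u t.
Proof.
move=> tu /right_rotation_weight; apply/negP; rewrite -leqNgt.
elim: tu => [v w /right_rotation_weight/ltnW //|//|v w x _ h1 _ h2].
exact: leq_trans h2 h1.
Qed.

Lemma top_vertex_dim F t : leaves t = n.+2 -> face Q F -> top_vertex Q F (pt t) ->
  (affine_dim F <= nright t)%N.
Proof.
move=> lt; rewrite {1}QE => Ff [_ Ft tmax].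
apply: (@affine_dim_no_rotation _ _ true) => // u tu Fu.
have lu := rotation_leaves tu; rewrite lt in lu.
by have /Q_tamari := tmax _ (vertexQ lu) Fu => /(_ lu lt) /tamari_le_antirotation; apply.
Qed.

(** At the bottom only left children count, and the left and right children together number n. *)
Lemma bottom_vertex_dim F t : leaves t = n.+2 -> face Q F -> bottom_vertex Q F (pt t) ->
  (affine_dim F + nright t <= n)%N.
Proof.
move=> lt; rewrite {1}QE => Ff [_ Ft tmin].
rewrite -{2}(size_all_kids lt) size_cat leq_add2r.
apply: (@affine_dim_no_rotation _ _ false) => // u ut Fu.
have lu := rotation_leaves ut; rewrite lt in lu.
by have /Q_tamari := tmin _ (vertexQ lu) Fu => /(_ lt lu) /tamari_le_antirotation; apply.
Qed.

Lemma face_leP F G : face_le Q F G -> exists t u,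
  [/\ leaves t = n.+2, leaves u = n.+2, top_vertex Q F (pt t),
      bottom_vertex Q G (pt u) & (nright t <= nright u)%N].
Proof.
move=> [v [w [Fv Gw vw]]].
have [vv _ _] := Fv; have [vw' _ _] := Gw.
have [t lt tE] := vertexQP vv; have [u lu uE] := vertexQP vw'; subst v w.
by exists t, u; split=> //; apply: tamari_le_kids; apply/Q_tamari.
Qed.

(** The top of [F i] bounds its dimension by right children. Going on from bottom to top of a face
    and from there to the next bottom, their number never drops. *)
Lemma face_chain_bottom k (F : 'I_k -> set 'rV[R]_n.+1) (i j : 'I_k) :
  face_chain Q F -> (i < j)%N -> exists t,
  [/\ leaves t = n.+2, bottom_vertex Q (F j) (pt t) & (affine_dim (F i) <= nright t)%N].
Proof.
move=> [Ff Fle]; case: j => j; elim: j => // j IH jk /=; rewrite ltnS leq_eqVlt.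
case/orP => [/eqP ij|ij].
  have [t [u [lt lu ht hu tu]]] := face_leP (Fle i (Ordinal jk) (congr1 succn (esym ij))).
  by exists u; split=> //; apply: leq_trans (top_vertex_dim lt (Ff i) ht) tu.
have [s [ls hs ds]] := IH (ltnW jk) ij.
have [t [u [lt lu ht hu tu]]] := face_leP (Fle (Ordinal (ltnW jk)) (Ordinal jk) erefl).
exists u; split=> //; apply: leq_trans ds (leq_trans _ tu).
apply: tamari_le_kids; apply/Q_tamari => //.
by have [_ _ tmax] := ht; have [vs Fs _] := hs; apply: tmax.
Qed.

Lemma face_chain_dim k (F : 'I_k -> set 'rV[R]_n.+1) (i j : 'I_k) :
  face_chain Q F -> (i < j)%N -> (affine_dim (F i) + affine_dim (F j) <= n)%N.
Proof.
move=> FF ij; have [t [lt ht dt]] := face_chain_bottom FF ij.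
have := bottom_vertex_dim lt (FF.1 j) ht; lia.
Qed.

(* Each face is paired with the next one, and the last one with the first. *)
Lemma face_chain_sum k (F : 'I_k -> set 'rV[R]_n.+1) : (1 < k)%N -> face_chain Q F ->
  (2 * \sum_(i < k) affine_dim (F i) <= k * n)%N.
Proof.
case: k F => [|[|k]] // F _ FF.
rewrite mul2n -addnn {2}(reindex_inj (@ordS_inj k.+2)) -big_split /=.
rewrite -[in leqRHS](card_ord k.+2) -sum_nat_const; apply: leq_sum => i _.
have : i != ordS i :> nat.
  rewrite /=; have := ltn_ord i; rewrite leq_eqVlt => /orP[/eqP h|h].
    by rewrite h modnn; lia.
  by rewrite modn_small //; lia.
rewrite neq_ltn => /orP[|] h; first exact: face_chain_dim h.
by rewrite addnC; exact: face_chain_dim h.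
Qed.

Lemma excessE k (F : 'I_k -> set 'rV[R]_n.+1) :
  excess Q F = n%:Z - 1 + k%:Z - (\sum_(i < k) affine_dim (F i))%N%:Z.
Proof.
rewrite /excess QE affine_dim_associahedron sumrB sumr_const card_ord.
by rewrite (big_morph Posz PoszD (erefl 0%:Z)) natz opprB addrA.
Qed.

Lemma chain_word_face_chain k : (k <= n./2)%N ->
  face_chain Q (fun i : 'I_k => @cube R n (chain_word n i)).
Proof.
move=> kn; have sz := @size_chain_word n.
have hi (i : 'I_k) : (i <= n./2)%N by have := ltn_ord i; lia.
split=> [i|i j ji].
  by rewrite QE; have [] := cubeP R true (sz _ (hi i)).
have [fi ti ri] := cubeP R true (sz _ (hi i)).
have [fj tj rj] := cubeP R false (sz _ (hi j)).
have li := leaves_spine true (sz _ (hi i)); have lj := leaves_spine false (sz _ (hi j)).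
exists (pt (spine (resolve true (chain_word n i)))).
exists (pt (spine (resolve false (chain_word n j)))).
split.
- by apply: top_vertex_no_rotation => //; rewrite QE.
- by apply: bottom_vertex_no_rotation => //; rewrite QE.
- rewrite ji resolve_chain_word; first exact: rt_refl.
  by have := hi j; rewrite ji.
Qed.

(** A constant chain at one vertex, so that the minimum excess exists even when n is too small for
    the cubes. *)
Lemma exists_chain k : exists F : 'I_k -> set 'rV[R]_n.+1, face_chain Q F.
Proof.
have lt : leaves (left_comb n.+1) = n.+2 by exact: leaves_left_comb.
have v := vertexQ lt; exists (fun=> [set pt (left_comb n.+1)]); split=> // i j _.
exists (pt (left_comb n.+1)), (pt (left_comb n.+1)); split; last exact: rt_refl.
- by split=> // w _ ->; apply: rt_refl.
- by split=> // w _ ->; apply: rt_refl.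
Qed.

(** For fixed k both bounds are (1 - k/2) n + O(1). The upper one uses k cubes of dimension at least
    n/2 - k. *)
Lemma is_min_excess_bounds k : (1 < k)%N -> exists e,
  [/\ is_min_excess Q k e, 2 * n%:Z - 2 + 2 * k%:Z - k%:Z * n%:Z <= 2 * e &
      (2 * k <= n)%N -> e <= n%:Z - 1 + k%:Z - k%:Z * (n./2%:Z - k%:Z)].
Proof.
move=> k1.
have lower (F : 'I_k -> set 'rV[R]_n.+1) : admissible_chain Q F ->
    2 * n%:Z - 2 + 2 * k%:Z - k%:Z * n%:Z <= 2 * excess Q F.
  move=> [FF _]; rewrite excessE; have := face_chain_sum k1 FF.
  by rewrite -lez_nat !PoszM; lia.
pose A e := exists F : 'I_k -> set 'rV[R]_n.+1, admissible_chain Q F /\ excess Q F = e.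
have adm (F : 'I_k -> set 'rV[R]_n.+1) : face_chain Q F -> admissible_chain Q F.
  by move=> FF; split=> // k1'; rewrite k1' in k1.
(* Half of the sharp lower bound need not be an integer; this cruder bound is enough for the minimum
   to exist. *)
have [||e [[F [FF Fe]] emin]] := @int_minimum A (n%:Z - 1 + k%:Z - k%:Z * n%:Z).
- by have [F FF] := exists_chain k; exists (excess Q F), F; split=> //; apply: adm.
- move=> z [F [FF <-]]; have := lower _ FF.
  have : 0 <= k%:Z * n%:Z by [].
  by lia.
exists e; split.
- by split; [exists F | move=> G GG; apply: emin; exists G].
- by rewrite -Fe; apply: lower.
- move=> kn; have kn2 : (k <= n./2)%N by lia.
  have CC := chain_word_face_chain kn2.
  apply: le_trans (emin _ (ex_intro _ _ (conj (adm _ CC) erefl))) _.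
  rewrite excessE lerD2l lerN2.
  have : (\sum_(i < k) (n./2 - k) <= \sum_(i < k) affine_dim (@cube R n (chain_word n i)))%N.
    apply: leq_sum => i _; have ik := ltn_ord i.
    have in2 : (i <= n./2)%N by lia.
    apply: leq_trans (affine_dim_cube R (size_chain_word in2)).
    by rewrite stars_chain_word; lia.
  by rewrite sum_nat_const card_ord -lez_nat PoszM -subzn.
Qed.

(** The trivial chain being excluded, a facet is optimal and has excess (n - 1) - (n - 2). *)
Lemma is_min_excess1 : (0 < n)%N -> is_min_excess Q 1 1.
Proof.
move=> n0; split.
  have [F [Ff FP dF]] := exists_facet R n0; exists (fun=> F); split.
    split; last by rewrite QE.
    split=> [_|i j]; first by rewrite QE.
    by rewrite !ord1.
  by rewrite excessE big_ord1; lia.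
move=> F [[Ff _] FP]; rewrite excessE big_ord1.
have := Ff ord0; rewrite QE => Ff0.
have : (affine_dim (F ord0) < n)%N.
  by apply: affine_dim_proper_face => //; have := FP erefl ord0; rewrite QE.
lia.
Qed.

Lemma excess2_gt0 (F : 'I_2 -> set 'rV[R]_n.+1) : face_chain Q F -> 0 < excess Q F.
Proof.
move=> FF; have := @face_chain_dim _ F ord0 ord_max FF isT.
rewrite excessE big_ord_recl big_ord1 (_ : lift _ _ = ord_max); first lia.
exact/val_inj.
Qed.

End Excess.

(** * Asymptotics *)

Section Limits.
Variable R : realType.
Local Notation alpha k := ((k%:R - 2) / (2 * k%:R - 2) : R).

Lemma alpha_cvg : (fun k => if k == 1%N then 1 else alpha k) @ \oo --> (1 / 2 : R).
Proof.
apply/cvgrPdist_le => eps eps0; near=> k.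
have k2 : (2 <= k)%N by near: k; exact: nbhs_infty_ge.
have ke : eps^-1 + 2 <= k%:R by near: k; exact: nbhs_infty_ger.
have k2' : 2 <= k%:R :> R by rewrite ler_nat.
rewrite ifF; last by lia.
have -> : 1 / 2 - alpha k = (2 * k%:R - 2)^-1.
  by field; apply/negP => /eqP; lra.
have pos : 0 < 2 * k%:R - 2 :> R by lra.
rewrite gtr0_norm ?invr_gt0 // -[leRHS]invrK lef_pV2 ?posrE ?invr_gt0 //.
lra.
Unshelve. all: by end_near. Qed.

Lemma excess_ratio_cvg k (e : nat -> int) C : (1 < k)%N ->
  (forall n, (2 * k <= n)%N -> `|2 * e n - (2 - k%:Z) * n%:Z| <= C) ->
  (fun n => (e n)%:~R / (E_ k n)%:~R : R) @ \oo --> alpha k.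
Proof.
move=> k1 he; apply/cvgrPdist_le => eps eps0.
have k1' : 2 <= k%:R :> R by rewrite ler_nat.
near=> n.
have kn : (2 * k <= n)%N by near: n; exact: nbhs_infty_ge.
(* The denominator exceeds n - 2k in absolute value, and the doubled numerator error is at most C +
   2 (2k - 1), below C + 4k. *)
have ne : (C%:~R + 4 * k%:R) / eps + 2 * k%:R <= n%:R :> R by near: n; exact: nbhs_infty_ger.
have kn' : 2 * k%:R <= n%:R :> R by rewrite -natrM ler_nat.
set x : R := (e n)%:~R.
have hx : `|2 * x - (2 - k%:R) * n%:R| <= C%:~R.
  have := he n kn; rewrite -(ler_int R) intr_norm.
  by rewrite !(rmorphB, rmorphM) /= -!pmulrn.
have -> : (E_ k n)%:~R = - ((k%:R - 1) * n%:R - (2 * k%:R - 1)) :> R.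
  by rewrite /E_ !(rmorphB, rmorphM) /= -!pmulrn; ring.
set D := (k%:R - 1) * n%:R - (2 * k%:R - 1).
have Dn : n%:R - 2 * k%:R < D.
  have : 0 <= (k%:R - 2) * n%:R :> R by rewrite mulr_ge0 //; lra.
  by rewrite /D; lra.
have D0 : 0 < D by lra.
have a0 : 0 <= alpha k <= 1.
  by rewrite divr_ge0 /= ?ler_pdivrMr; lra.
have -> : alpha k - x / - D = (alpha k * D + x) / D.
  by field; rewrite !gt_eqF //; lra.
rewrite normrM normfV (gtr0_norm D0) ler_pdivrMr //.
(* The terms linear in n cancel, since 2 alpha (k - 1) = k - 2. *)
have E : 2 * (alpha k * D + x) = (2 * x - (2 - k%:R) * n%:R) - 2 * alpha k * (2 * k%:R - 1).
  by rewrite /D; field; apply/negP => /eqP; lra.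
have C0 : 0 <= C%:~R :> R by apply: le_trans hx.
have : C%:~R + 4 * k%:R <= eps * D.
  have : (C%:~R + 4 * k%:R) / eps <= D by lra.
  by rewrite ler_pdivrMr // (mulrC eps).
have ak : 0 <= alpha k * (2 * k%:R - 1) <= 2 * k%:R - 1.
  by move/andP: a0 => [a0 a1]; rewrite mulr_ge0 ?ler_piMl //; lra.
move: hx E ak; rewrite !ler_norml -mulrA.
move: (alpha k * (2 * k%:R - 1)) => y hx E /andP[y0 y1] hD.
by apply/andP; move/andP: hx => [h1 h2]; split; lra.
Unshelve. all: by end_near. Qed.

End Limits.

(** * Asymptotic lengths of the associahedra *)

Section Main.
Variables (R : realType) (K : polytope_family R S).
Hypothesis KP : tamari_associahedra K.

Lemma asymptotic_length_tamari k : (1 < k)%N ->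
  asymptotic_length K k ((k%:R - 2) / (2 * k%:R - 2)).
Proof.
move=> k1.
have [e he] : {e : nat -> int & forall n, (0 < n)%N ->
    [/\ is_min_excess (K n) k (e n), 2 * n%:Z - 2 + 2 * k%:Z - k%:Z * n%:Z <= 2 * e n &
      (2 * k <= n)%N -> e n <= n%:Z - 1 + k%:Z - k%:Z * (n./2%:Z - k%:Z)]}.
  apply: (@choice _ _ (fun n e => (0 < n)%N -> [/\ is_min_excess (K n) k e, _ <= 2 * e &
      (2 * k <= n)%N -> e <= n%:Z - 1 + k%:Z - k%:Z * (n./2%:Z - k%:Z)])) => n.
  case: n => [|n]; first by exists 0.
  by have [E T] := KP (ltn0Sn n); have [e] := is_min_excess_bounds E T k1; exists e.
exists e; split=> [n /he[]//|].
(* After doubling, 2 k^2 comes from the deficits of the k cubes, one k from rounding n/2 down, and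
   2k - 2 from the constants in the excess. *)
apply: (@excess_ratio_cvg R k e (2 * k%:Z * k%:Z + 3 * k%:Z + 2)) => // n kn.
have [|_ h1 h2] := he n; first lia.
have kn2 : k%:Z * n%:Z <= k%:Z * (2 * n./2%:Z + 1) by apply: ler_wpM2l => //; lia.
move: h1 (h2 kn) kn2 ; rewrite ler_norml.
set a := k%:Z * n%:Z; rewrite !mulrBr !mulrBl !mulrDr.
nia.
Qed.

End Main.

Theorem theorem3p5 (R : realType) :
  (exists K : polytope_family R S, tamari_associahedra K) /\
  (forall K : polytope_family R S, tamari_associahedra K ->
     [/\ graded K,
         two_short K,
         (forall k, (2 < k)%N ->
            asymptotic_length K k ((k%:R - 2) / (2 * k%:R - 2)))
       & asymptotic_total_length K (1 / 2)]).
Proof.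
split; first by exists (tamari_family R); apply: tamari_familyP.
move=> K KP; split.
- by move=> n n0; have [-> _] := KP n n0; apply: affine_dim_associahedron.
- by move=> n n0 F FF; have [E T] := KP n n0; apply: excess2_gt0.
- by move=> k k2; apply: asymptotic_length_tamari => //; apply: ltnW.
(* The formula also covers k = 2. At k = 1 its denominator is zero, and the limit is 1 because e_1
   and E_1 are both constantly 1. *)
- exists (fun k => if k == 1%N then 1 else (k%:R - 2) / (2 * k%:R - 2)).
  split; last exact: alpha_cvg.
  move=> k k0; have [->|k1] := eqVneq k 1%N; last first.
    by apply: asymptotic_length_tamari; rewrite // ltn_neqAle eq_sym k1.
  exists (fun=> 1); split=> [n n0|].
    by have [E _] := KP n n0; apply: is_min_excess1.
  rewrite (_ : (fun n => _) = (fun=> 1)); first exact: cvg_cst.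
  apply/funext => n; rewrite /E_ (_ : _ - _ * _ = 1) ?divr1 //.
  by rewrite mul1r; lia.
Qed.
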